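(* Let $\mathbf G$ be a compact metric graph without cycles. For each $p>1$, let $u_p$ be a least energy solution of the Kirchhoff--Neumann Lane--Emden problem on $\mathbf G$. Then, for every sequence $\{p_n\}$ with $p_n\to\infty$, there exist a subsequence, still denoted by $\{p_n\}$, and a pair $(a_*,b_* )\in\mathcal D$ such that $$u_{p_n}\longrightarrow u_\infty$$ strongly in $H^1(\mathbf G)$ and uniformly on $\mathbf G$, where $u_\infty$ is a minimizer of the variational problem $$S_\infty^N(\mathbf G)=\inf\Big\{\int_{\mathbf G}|\nabla u|^2dx:\ u\in H^1(\mathbf G),\ \max_{\mathbf G}u=1,\ \min_{\mathbf G}u=-1\Big\}$$ and satisfies $u_\infty(a_* )=-1$, $u_\infty(b_* )=1$. Moreover, if $\mathbf U$ denotes the unique path joining $a_*$ and $b_*$, then $$u_\infty(x)=-1+\frac{2\operatorname{dist}(a_*,x)}{\operatorname{dist}(a_*,b_* )},\qquad x\in\mathbf U,$$ and $u_\infty$ is constant on each connected component of $\mathbf G\setminus\mathbf U$.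
   Context: Graphs. $\mathbf G=\mathbf G(\mathbf V,\mathbf E)$ is a graph with vertex set $\mathbf V$ and edge set $\mathbf E$; it is connected, has finitely many edges, contains no loops, and no vertex has degree $2$. It is a compact metric graph: each edge $\mathbf e$ is identified with an interval $[0,l(\mathbf e)]$ with $0<l(\mathbf e)<\infty$. $\operatorname{dist}$ is the shortest-path distance on $\mathbf G$. $\mathbf V_{int}$ is the set of vertices of degree $\ge3$, $\mathbf V_{end}$ the set of vertices of degree $1$, and $\mathbf V=\mathbf V_{int}\sqcup\mathbf V_{end}$. Write $\mathbf e\succ\mathbf v$ if $\mathbf e$ is incident to $\mathbf v$. A cycle is a closed path consisting of distinct edges and vertices, except for its initial and terminal vertex, which coincide. $\mathcal D=\{(a,b)\in\mathbf G\times\mathbf G:\ \operatorname{dist}(a,b)=\max_{x,y\in\mathbf G}\operatorname{dist}(x,y)\}$. Function spaces. $u^{(\mathbf e)}$ is the restriction of $u$ to $\mathbf e$, $\nabla=\frac{d}{dx}$, $\Delta=\frac{d^2}{dx^2}$ on each edge, $\int_{\mathbf G}=\sum_{\mathbf e}\int_0^{l(\mathbf e)}$. $H^1(\mathbf G)$ is the space of continuous $u$ on $\mathbf G$ with $u^{(\mathbf e)}\in H^1(\mathbf e)$ for all $\mathbf e$, with $\|u\|_{H^1(\mathbf G)}^2=\int_{\mathbf G}(|\nabla u|^2+u^2)dx$. Least energy solutions. The Kirchhoff--Neumann Lane--Emden problem is: $u$ continuous on $\mathbf G$; $-\Delta u^{(\mathbf e)}=|u^{(\mathbf e)}|^{p-1}u^{(\mathbf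 e)}$ on each edge; $\sum_{\mathbf e\succ\mathbf v}\partial u^{(\mathbf e)}(\mathbf v)=0$ for each $\mathbf v\in\mathbf V_{int}$; $\partial u^{(\mathbf e)}(\mathbf v)=0$ for each $\mathbf v\in\mathbf V_{end}$ (with $\mathbf e\succ\mathbf v$). Here $\partial u^{(\mathbf e)}(\mathbf v)$ is the outward derivative at $\mathbf v$ along $\mathbf e$ (direction from $\mathbf v$ into $\mathbf e$). Let $J_p(u)=\frac12\int_{\mathbf G}|\nabla u|^2dx-\frac1{p+1}\int_{\mathbf G}|u|^{p+1}dx$, $\mathcal A_p=\{u\in H^1(\mathbf G)\setminus\{0\}:\int_{\mathbf G}|u|^{p-1}u\,dx=0\}$, $\sigma_p^N=\inf_{u\in\mathcal A_p}\sup_{t>0}J_p(tu)$. A least energy solution is a solution $u_p$ of this problem with $J_p(u_p)=\sigma_p^N$; one exists for each $p>1$. *)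

(* Defs.v *)
From HB Require Import structures.
From mathcomp Require Import all_boot all_order all_algebra.
From mathcomp Require Import all_classical all_reals all_analysis.
Import Order.TTheory GRing.Theory Num.Theory numFieldNormedType.Exports.

Set Implicit Arguments.
Unset Strict Implicit.
Unset Printing Implicit Defensive.

Local Open Scope classical_set_scope.
Local Open Scope ring_scope.

(* Parallel edges are allowed.  The orientation of an edge [e] from [src e] to
   [tgt e] only serves to parametrize it by [0, len e]. *)
Record multigraph (R : realType) := Multigraph {
  vertex : finType;
  edge : finType;
  src : edge -> vertex;
  tgt : edge -> vertex;
  len : edge -> R }.

Definition incident (R : realType) (G : multigraph R)
  (e : edge G) (v : vertex G) : bool := (src e == v) || (tgt e == v).

(* As there are no loops, the degree is the number of incident edges. *)
Definition degree (R : realType) (G : multigraph R) (v : vertex G) : nat :=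
  #|[set e | incident e v]%SET|.

Definition adjacent (R : realType) (G : multigraph R) : rel (vertex G) :=
  fun v w => [exists e, (v != w) && incident e v && incident e w].

(* The degree condition states that there is no vertex of degree 2 and that every
   vertex has degree 1 or at least 3, so the one-point graph is excluded. *)
Record metric_graph (R : realType) := MetricGraph {
  mgraph :> multigraph R;
  len_gt0 : forall e : edge mgraph, 0 < len e;
  loopless : forall e : edge mgraph, src e != tgt e;
  vertex_inhabited : (0 < #|vertex mgraph|)%N;
  graph_connected : forall v w : vertex mgraph, connect (@adjacent R mgraph) v w;
  degree_1_or_ge3 : forall v : vertex mgraph,
    (degree v == 1%N) || (3 <= degree v)%N }.

Section Cycles.
Context {R : realType} (G : metric_graph R).

(* [(e, true)] is the edge [e] traversed from [src e] to [tgt e], and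
   [(e, false)] the same edge traversed backwards. *)
Definition dart_src (d : edge G * bool) : vertex G :=
  if d.2 then src d.1 else tgt d.1.
Definition dart_tgt (d : edge G * bool) : vertex G :=
  if d.2 then tgt d.1 else src d.1.

Fixpoint is_walk (v : vertex G) (ds : seq (edge G * bool)) (w : vertex G) : bool :=
  if ds is d :: ds' then (dart_src d == v) && is_walk (dart_tgt d) ds' w
  else v == w.

Definition is_cycle (v : vertex G) (ds : seq (edge G * bool)) : bool :=
  [&& ds != [::], is_walk v ds v,
      uniq [seq d.1 | d <- ds] & uniq [seq dart_src d | d <- ds]].

Definition without_cycles : Prop :=
  forall (v : vertex G) (ds : seq (edge G * bool)), ~~ is_cycle v ds.

End Cycles.

(* A point is a vertex or a pair [(e, t)] with [0 < t < len e]. *)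
Definition gpoint (R : realType) (G : metric_graph R) : Type :=
  (vertex G + {et : edge G * R | 0 < et.2 < len et.1})%type.

HB.instance Definition _ (R : realType) (G : metric_graph R) :=
  Choice.copy (gpoint G)
    (vertex G + {et : edge G * R | 0 < et.2 < len et.1})%type.

(* The identification of [0, len e] with the closed edge [e], extended to all of
   R by clamping: [src e] for [t <= 0] and [tgt e] for [t >= len e]. *)
Definition chart (R : realType) (G : metric_graph R) (e : edge G) (t : R) :
    gpoint G :=
  if insub (e, t) is Some z then inr z
  else inl (if t <= 0 then src e else tgt e).

(* The topology of the graph is the quotient topology of the disjoint union of
   the closed edges; since clamping R -> [0, len e] is a quotient map, the
   preimages of open sets can be required to be open in R. *)
Definition gopen (R : realType) (G : metric_graph R) : set_system (gpoint G) :=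
  [set A | forall e : edge G, open (@chart R G e @^-1` A)].

Section Topology.
Context {R : realType} (G : metric_graph R).

Lemma gopenT : gopen [set: gpoint G].
Proof. by move=> e; rewrite preimage_setT; exact: openT. Qed.

Lemma gopenI : setI_closed (@gopen R G).
Proof. by move=> A B oA oB e; rewrite preimage_setI; exact: openI. Qed.

Lemma gopen_bigU (I : Type) (f : I -> set (gpoint G)) :
  (forall i, gopen (f i)) -> gopen (\bigcup_i f i).
Proof.
by move=> oA e; rewrite preimage_bigcup; apply: bigcup_open => i _; exact: oA.
Qed.

HB.instance Definition _ :=
  isOpenTopological.Build (gpoint G) gopenT gopenI gopen_bigU.

End Topology.

Section Distance.
Context {R : realType} (G : metric_graph R).

(* A chain is a concatenation of segments [(e, s, t)], each running inside the
   edge [e] from the parameter [s] to the parameter [t]. *)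
Fixpoint is_chain (x : gpoint G) (c : seq (edge G * R * R)) (y : gpoint G) :
    Prop :=
  if c is (e, s, t) :: c' then
    [/\ 0 <= s <= len e, 0 <= t <= len e, chart e s = x
      & is_chain (chart e t) c' y]
  else x = y.

Definition chain_length (c : seq (edge G * R * R)) : R :=
  \sum_(z <- c) `|z.2 - z.1.2|.

Definition dist (x y : gpoint G) : R :=
  inf [set chain_length c | c in [set c | is_chain x c y]].

Definition diametral (a b : gpoint G) : Prop :=
  forall x y : gpoint G, dist x y <= dist a b.

(* [U] is the trace of a path (an injective continuous curve) from [a] to [b]. *)
Definition is_path (a b : gpoint G) (U : set (gpoint G)) : Prop :=
  exists gam : R -> gpoint G,
    [/\ {within `[0, 1], continuous gam}, {in `[0, 1] &, injective gam},
        gam 0 = a, gam 1 = b & U = gam @` `[0, 1]].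

End Distance.

Section SobolevInterval.
Context {R : realType}.
Local Notation mu := (@lebesgue_measure R).

Definition square_integrable (l : R) (g : R -> R) : Prop :=
  measurable_fun `]0, l[ g /\
  mu.-integrable `]0, l[ (fun x => (g x ^+ 2)%:E).

(* Test functions are taken in C^1_c(]0, l[), which yields the same weak
   derivatives as C^oo_c(]0, l[). *)
Definition test_function (l : R) (phi : R -> R) : Prop :=
  [/\ forall x, derivable phi x 1, continuous (derive1 phi)
    & exists a b, [/\ 0 < a, b < l & forall x, x \notin `[a, b] -> phi x = 0]].

Definition is_weak_derivative (l : R) (f g : R -> R) : Prop :=
  forall phi : R -> R, test_function l phi ->
    \int[mu]_(x in `]0, l[) (f x * derive1 phi x) =
    - \int[mu]_(x in `]0, l[) (g x * phi x).

Definition sobolev_H1 (l : R) (f : R -> R) : Prop :=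
  square_integrable l f /\
  exists2 g, square_integrable l g & is_weak_derivative l f g.

(* A representative of the weak derivative; it is determined up to a null set,
   and is 0 by convention when [f] has no weak derivative in L^2. *)
Definition weak_derivative (l : R) (f : R -> R) : R -> R :=
  xget (fun _ => 0) [set g | square_integrable l g /\ is_weak_derivative l f g].

End SobolevInterval.

Section FunctionsOnGraphs.
Context {R : realType} (G : metric_graph R).
Local Notation mu := (@lebesgue_measure R).
Implicit Types (u : gpoint G -> R) (e : edge G) (v : vertex G).

Definition restr u e : R -> R := fun t => u (chart e t).

Definition graph_integral (h : edge G -> R -> R) : R :=
  \sum_(e : edge G) \int[mu]_(x in `]0, len e[) h e x.

Definition H1 u : Prop :=
  continuous u /\ forall e, sobolev_H1 (len e) (restr u e).

Definition grad u e : R -> R := weak_derivative (len e) (restr u e).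

Definition dirichlet u : R := graph_integral (fun e x => `|grad u e x| ^+ 2).

Definition norm_H1 u : R :=
  Num.sqrt (graph_integral (fun e x => `|grad u e x| ^+ 2 + restr u e x ^+ 2)).

Definition cvg_H1 (u_ : nat -> gpoint G -> R) u : Prop :=
  [/\ forall n, H1 (u_ n), H1 u
    & norm_H1 (fun x => u_ n x - u x) @[n --> \oo] --> (0 : R)].

Definition outward_quotient u e v (h : R) : R :=
  (restr u e (if src e == v then h else len e - h) - u (inl v)) / h.

Definition outward_derivable u e v : Prop :=
  cvg (outward_quotient u e v h @[h --> 0^'+]).

Definition outward_derivative u e v : R :=
  lim (outward_quotient u e v h @[h --> 0^'+]).

Definition lane_emden_solution (p : R) u : Prop :=
  [/\ continuous u,
      forall e x, x \in `]0, len e[ ->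
        [/\ derivable (restr u e) x 1, derivable (derive1 (restr u e)) x 1
          & - derive1 (derive1 (restr u e)) x =
            (`|restr u e x| `^ (p - 1)) * restr u e x],
      forall e v, incident e v -> outward_derivable u e v,
      forall v, (3 <= degree v)%N ->
        \sum_(e | incident e v) outward_derivative u e v = 0
    & forall v, degree v = 1%N -> forall e, incident e v ->
        outward_derivative u e v = 0].

Definition energy (p : R) u : R :=
  dirichlet u / 2 -
  (p + 1)^-1 * graph_integral (fun e x => `|restr u e x| `^ (p + 1)).

Definition admissible (p : R) u : Prop :=
  [/\ H1 u, u <> (fun _ => 0)
    & graph_integral (fun e x => (`|restr u e x| `^ (p - 1)) * restr u e x) = 0].

Definition least_energy (p : R) : \bar R :=
  ereal_inf [set ereal_sup [set (energy p (fun x => t * u x))%:E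
                           | t in [set t : R | 0 < t]]
            | u in [set u | admissible p u]].

Definition least_energy_solution (p : R) u : Prop :=
  lane_emden_solution p u /\ (energy p u)%:E = least_energy p.

Definition limit_admissible u : Prop :=
  [/\ H1 u,
      (forall x, u x <= 1) /\ (exists x, u x = 1)
    & (forall x, -1 <= u x) /\ (exists x, u x = -1)].

Definition S_infty : R :=
  inf [set dirichlet u | u in [set u | limit_admissible u]].

Definition limit_minimizer u : Prop :=
  limit_admissible u /\ dirichlet u = S_infty.

End FunctionsOnGraphs.

Arguments least_energy {R} G p.
Arguments S_infty {R} G.

(* Main.v *)
Require Import Defs.
From mathcomp Require Import all_boot all_order all_algebra.
From mathcomp Require Import all_classical all_reals all_analysis.
From mathcomp Require Import measurable_realfun ring lra.
Import Order.TTheory GRing.Theory Num.Theory numFieldNormedType.Exports.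

Set Implicit Arguments.
Unset Strict Implicit.
Unset Printing Implicit Defensive.

Local Open Scope classical_set_scope.
Local Open Scope ring_scope.


(** Removing an edge [e] of a tree leaves two sides, so each point has a
    coordinate [coord e] in [[0, len e]], its projection onto [e]. Along an edge
    only the coordinate of that edge moves. Hence the increment of any function
    between two points is the sum of its increments along the edges between
    their projections ([increment_decomposition]), the distance is the sum of
    the differences of the coordinates ([distE]), and the path between two
    vertices is cut out by conditions on the coordinates ([path_is_geodesic]).
    Cauchy-Schwarz on every edge, summed up, gives [increment_le]:
    [(u y - u x) ^ 2 <= dist x y * D u], where [D] is the Dirichlet integral.
    Write [d] for the diameter. An admissible function of the limit problem goes
    from [-1] to [1], so [D >= 4 / d], and the profile of a diametral pair,
    affine on its path and constant on the branches, attains this bound.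

    Let [u] be a least energy solution with exponent [p]. Testing the equation
    with [u] and with [1] gives [D u = \int |u| ^ (p + 1)] and
    [\int |u| ^ (p - 1) u = 0]; thus the energy is [(1 / 2 - 1 / (p + 1)) * D u].
    - The profile plus the constant that makes it admissible is at least almost [1]
      in absolute value on a segment next to an end of the path. For large [p] the
      power term of a multiple that exceeds [1] there outweighs the quadratic term,
      so the maximum of the energy on the ray is at most about [2 / d]
      ([least_energy_upper]). So [D u <= 4 / d + eps].
    - Every admissible function is bounded by its oscillation, which keeps the
      least energy, hence [D u], away from [0] ([least_energy_lower]).
    - If [u <= r < 1], then the positive part of [|u| ^ (p - 1) u] is at most
      [r ^ p], and so is its negative part in the mean; then the integral of
      [|u| ^ (p + 1)] tends to [0], contrary to the previous point. So
      [max u >= 1 - eps], and likewise [min u <= -1 + eps] ([max_lower]).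

    By [increment_le] the extrema of [u] are then at distance nearly [d]. Any two
    points extend to two vertices at least as far apart, and there are finitely
    many vertices, so the extrema lie near vertices [v] and [w] at distance
    exactly [d]. The half sum of [u] and of the profile of [v] and [w] still rises by
    about [2] from [v] to [w], so its Dirichlet integral is at least about
    [4 / d], and the parallelogram identity makes that of the difference small
    ([concentration]). By [increment_le] again the difference is uniformly small.
    Only the pair [(v, w)] depends on [p]; passing to a subsequence fixes it. *)


(** * Coordinates on a tree *)

Section TreeCoordinates.
Context {R : realType} (G : metric_graph R).
Implicit Types (e g : edge G) (v w : vertex G) (x y z : gpoint G) (t : R).

Definition linked_off e : rel (vertex G) :=
  fun v w => [exists g, [&& g != e, incident g v & incident g w]].

Definition src_side e v : bool := connect (linked_off e) (src e) v.

(** On a tree, [coord e] is the projection of the graph onto the closed edge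
    [e]; it is constant on each side of [e]. *)
Definition coord e x : R :=
  match x with
  | inl v => if src_side e v then 0 else len e
  | inr z => if (val z).1 == e then (val z).2
             else if src_side e (src (val z).1) then 0 else len e
  end.

(** The edges of the constructed walk have both ends in [v :: p], which is what
    makes them distinct: the first one contains [v] and the others do not. *)
Lemma walk_of_path e v p : path (linked_off e) v p -> uniq (v :: p) ->
  exists ds : seq (edge G * bool),
    [/\ is_walk v ds (last v p), [seq dart_src d | d <- ds] = belast v p,
        uniq [seq d.1 | d <- ds], {in ds, forall d, d.1 != e}
      & forall d a, d \in ds -> incident d.1 a -> a \in v :: p].
Proof.
elim: p v => [|w p IH] v /=.
  by move=> _ _; exists [::]; split=> //=; rewrite eqxx.
move=> /andP[/existsP[g /and3P[ge gv gw]] pth] /and3P[].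
rewrite inE negb_or => /andP[vw vp] wp up.
have [|ds [wk ds_src ds_uniq ds_off ds_in]] := IH w pth; first by rewrite /= wp.
have gv_cases : exists b, dart_src (g, b) = v /\ dart_tgt (g, b) = w.
  move: gv gw; rewrite /incident /dart_src /dart_tgt.
  case/orP=> /eqP gv /orP[]/eqP gw.
  - by move: vw; rewrite -gv -gw eqxx.
  - by exists true.
  - by exists false.
  - by move: vw; rewrite -gv -gw eqxx.
case: gv_cases => b [bv bw]; exists ((g, b) :: ds); split=> /=.
- by rewrite bv eqxx bw.
- by rewrite bv ds_src.
- rewrite ds_uniq andbT; apply/negP => /mapP[d dds gd].
  have := ds_in d v dds; rewrite -gd => /(_ gv).
  by rewrite inE (negPf vw) (negPf vp).
- by move=> d; rewrite inE => /predU1P[->//|]; exact: ds_off.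
- move=> d x; rewrite inE => /predU1P[->|dds] /= dx; last first.
    by rewrite inE (ds_in d x dds dx) orbT.
  move: dx bv bw; rewrite /incident /dart_src /dart_tgt /= => /orP[]/eqP <-.
    by case: b => <- <-; rewrite !inE eqxx ?orbT.
  by case: b => <- <-; rewrite !inE eqxx ?orbT.
Qed.

Lemma chart_le0 e t : t <= 0 -> chart e t = inl (src e).
Proof.
move=> t0; rewrite /chart; case: insubP => [z /andP[/= z1 _] _|_].
  by move: z1; rewrite ltNge t0.
by rewrite t0.
Qed.

Lemma chart0 e : chart e 0 = inl (src e).
Proof. exact: chart_le0. Qed.

Lemma chart_ge_len e t : len e <= t -> chart e t = inl (tgt e).
Proof.
move=> lt; rewrite /chart; case: insubP => [z /andP[/= _ z1] _|_].
  by move: z1; rewrite ltNge lt.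
by rewrite leNgt (lt_le_trans (len_gt0 e) lt).
Qed.

Lemma chart_len e : chart e (len e) = inl (tgt e).
Proof. exact: chart_ge_len. Qed.

Lemma chart_inside e t (h : 0 < t < len e) :
  chart e t = inr (exist (fun et : edge G * R => 0 < et.2 < len et.1) (e, t) h).
Proof.
rewrite /chart; case: insubP => [z _ zet|]; last by rewrite /= h.
by congr inr; apply: val_inj.
Qed.

Lemma itv_src e : 0 <= (0 : R) <= len e.
Proof. by rewrite le_refl ltW ?len_gt0. Qed.

Lemma itv_tgt e : 0 <= len e <= len e.
Proof. by rewrite le_refl ltW ?len_gt0. Qed.

Lemma gpoint_chart x : exists e t, 0 <= t <= len e /\ x = chart e t.
Proof.
case: x => [v|[[e t] /= h]]; last first.
  exists e, t; rewrite (chart_inside h); split=> //.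
  by case/andP: h => *; rewrite !ltW.
have [e] : exists e, incident e v.
  have : (0 < degree v)%N by have /orP[/eqP->//|] := degree_1_or_ge3 v; case: degree.
  by case/card_gt0P => e; rewrite inE; exists e.
case/orP => /eqP ev.
  by exists e, 0; rewrite itv_src chart0 ev.
by exists e, (len e); rewrite itv_tgt chart_len ev.
Qed.

(** Every use of the connectedness of the graph goes through this lemma. *)
Lemma constant_along_edges (T : Type) (f : gpoint G -> T) :
  (forall e t, 0 <= t <= len e -> f (chart e t) = f (chart e 0)) ->
  forall x y, f x = f y.
Proof.
move=> fe.
have fst e : f (inl (tgt e)) = f (inl (src e)).
  by rewrite -chart_len fe ?chart0// itv_tgt.
have finc e v : incident e v -> f (inl v) = f (inl (src e)).
  by case/orP => /eqP <-.
have fv v w : f (inl v) = f (inl w).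
  have /connectP[p pth ->] := graph_connected v w.
  elim: p v pth => //= a p IH v /andP[/existsP[e /andP[/andP[_ ev] ea]] pth].
  by rewrite -IH// (finc _ _ ev) (finc _ _ ea).
have fx x : exists v, f x = f (inl v).
  have [e [t [te ->]]] := gpoint_chart x.
  by exists (src e); rewrite fe// chart0.
by move=> x y; have [v ->] := fx x; have [w ->] := fx y.
Qed.

Context (acyclicG : without_cycles G).

(** Otherwise a simple path from [src e] to [tgt e] that avoids [e] is closed
    into a cycle by [e] itself. *)
Lemma edge_is_bridge e : ~~ src_side e (tgt e).
Proof.
apply/negP => /connectP[p pth pe].
move: pth pe; case/shortenP => q qth uq _ qe.
have [ds [wk ds_src ds_uniq ds_off _]] := walk_of_path qth uq.
have /negP := acyclicG (tgt e) ((e, false) :: ds); apply.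
rewrite /is_cycle /= /dart_src /dart_tgt /= eqxx qe wk ds_uniq andbT /=.
apply/andP; split.
  by rewrite andbT; apply/negP => /mapP[d + de]; move=> /ds_off; rewrite -de eqxx.
by move: uq; rewrite -[X in uniq X]/(src e :: q) lastI rcons_uniq -qe -ds_src.
Qed.

Lemma src_side_src e : src_side e (src e).
Proof. exact: connect0. Qed.

Lemma src_side_edge e g : g != e -> src_side e (tgt g) = src_side e (src g).
Proof.
move=> ge; apply/idP/idP => /connect_trans; apply; apply: connect1;
  by apply/existsP; exists g; rewrite ge /incident !eqxx ?orbT.
Qed.

Lemma coord_src e : coord e (inl (src e)) = 0.
Proof. by rewrite /= src_side_src. Qed.

Lemma coord_tgt e : coord e (inl (tgt e)) = len e.
Proof. by rewrite /= (negPf (edge_is_bridge e)). Qed.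

Lemma coord_chart e t : 0 <= t <= len e -> coord e (chart e t) = t.
Proof.
move=> /andP[t0 tl]; have [t0'|t0'] := leP t 0.
  by rewrite chart_le0// coord_src; apply/le_anti; rewrite t0 t0'.
have [tl'|tl'] := leP (len e) t.
  by rewrite chart_ge_len// coord_tgt; apply/le_anti; rewrite tl tl'.
by rewrite (@chart_inside e t) ?t0'//= eqxx.
Qed.

Lemma coord_chart_other e g t : g != e ->
  coord e (chart g t) = coord e (inl (src g)).
Proof.
move=> ge; have [t0'|t0'] := leP t 0; first by rewrite chart_le0.
have [tl'|tl'] := leP (len g) t.
  by rewrite chart_ge_len//= src_side_edge.
have h : 0 < t < len g by rewrite t0'.
by rewrite (chart_inside h)/= (negPf ge).
Qed.

Lemma coord_itv e x : 0 <= coord e x <= len e.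
Proof.
have [g [t [tg ->]]] := gpoint_chart x.
have [<-|ge] := eqVneq g e; first by rewrite coord_chart.
rewrite coord_chart_other //=.
by case: ifP; rewrite ?lexx ?ltW ?len_gt0.
Qed.

Lemma coord_vertex e v : coord e (inl v) = 0 \/ coord e (inl v) = len e.
Proof. by rewrite /=; case: ifP => _; [left|right]. Qed.

Lemma chart_coord e x : 0 < coord e x < len e -> chart e (coord e x) = x.
Proof.
have [g [t [tg ->]]] := gpoint_chart x.
have [ge|ge] := eqVneq g e; first by subst g; rewrite coord_chart.
rewrite coord_chart_other //=.
by case: ifP; rewrite ?ltxx ?andbF.
Qed.

(** The difference of the two sides, as a function of [y], is constant along
    every edge [g]: there only the summand of index [g] varies, and it varies
    as [u y] does. *)
Lemma increment_decomposition (u : gpoint G -> R) x y :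
  u y - u x = \sum_e (u (chart e (coord e y)) - u (chart e (coord e x))).
Proof.
pose F z := u z - \sum_e u (chart e (coord e z)).
have : F y = F x.
  apply: constant_along_edges => g t tg; rewrite /F.
  rewrite (bigD1 g)//= [in RHS](bigD1 g)//= !coord_chart ?itv_src//.
  rewrite !opprD !addrA !subrr !add0r; congr (- _).
  by apply: eq_bigr => e eg; rewrite !coord_chart_other// eq_sym.
rewrite /F sumrB; lra.
Qed.

Lemma coord_inj x y : (forall e, coord e x = coord e y) -> x = y.
Proof.
move=> xy; pose u z : R := (z == x)%:R.
have := increment_decomposition u x y.
rewrite big1 => [|e _]; last by rewrite xy subrr.
rewrite /u eqxx => /eqP; rewrite subr_eq0 => /eqP.
by case: eqVneq => [->//|_ /eqP]; rewrite eq_sym oner_eq0.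
Qed.

(** Off an edge [e] the coordinate of [e] is the one of an end of [e]; of two
    edges, each point lies off one, on the side of the other. *)
Lemma coord_laminar e g z : e != g ->
  coord e z = coord e (inl (src g)) \/ coord g z = coord g (inl (src e)).
Proof.
move=> eg.
pose P z := (coord e z == coord e (inl (src g))) ||
            (coord g z == coord g (inl (src e))).
have : P z = P (inl (src e)).
  have Pe t : P (chart e t) by rewrite /P (coord_chart_other t eg) eqxx orbT.
  have Pg t : P (chart g t) by rewrite /P (@coord_chart_other e g)// 1?eq_sym// eqxx.
  apply: constant_along_edges => k t _.
  have [->|ke] := eqVneq k e; first by rewrite !Pe.
  have [->|kg] := eqVneq k g; first by rewrite !Pg.
  by rewrite /P !(coord_chart_other _ ke) !(coord_chart_other _ kg).
by rewrite {2}/P eqxx orbT /P => /orP[/eqP|/eqP]; [left|right].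
Qed.

(** * The distance *)

(** It is the shortest-path distance, see [distE]. *)
Definition tdist x y : R := \sum_e `|coord e x - coord e y|.

Lemma tdistC x y : tdist x y = tdist y x.
Proof. by apply: eq_bigr => e _; rewrite distrC. Qed.

Lemma tdist_ge0 x y : 0 <= tdist x y.
Proof. exact: sumr_ge0. Qed.

Lemma tdistxx x : tdist x x = 0.
Proof. by rewrite /tdist big1// => e _; rewrite subrr normr0. Qed.

Lemma tdist_triangle y x z : tdist x z <= tdist x y + tdist y z.
Proof.
rewrite -big_split; apply: ler_sum => e _.
by rewrite (le_trans _ (ler_normD _ _))// addrA subrK.
Qed.

Lemma tdist_eq0 x y : tdist x y = 0 -> x = y.
Proof.
move=> /eqP; rewrite psumr_eq0// => /allP xy; apply: coord_inj => e.
have := xy e (mem_index_enum _); rewrite implyTb normr_eq0 subr_eq0.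
by move/eqP.
Qed.

Lemma tdist_edge e t x : 0 <= t <= len e ->
  tdist (chart e t) x = `|t - coord e x| +
    \sum_(g | g != e) `|coord g (inl (src e)) - coord g x|.
Proof.
move=> te; rewrite /tdist (bigD1 e)//= coord_chart//; congr (_ + _).
by apply: eq_bigr => g ge; rewrite coord_chart_other// eq_sym.
Qed.

Lemma tdist_chart e s t : 0 <= s <= len e -> 0 <= t <= len e ->
  tdist (chart e s) (chart e t) = `|s - t|.
Proof.
move=> se te; rewrite tdist_edge// coord_chart// big1 ?addr0// => g ge.
by rewrite coord_chart_other 1?eq_sym// subrr normr0.
Qed.

Lemma tdist_le_chain c x y : is_chain x c y -> tdist x y <= chain_length c.
Proof.
rewrite /chain_length; elim: c x => [|[[e s] t] c IH] x /=.
  by move=> ->; rewrite big_nil tdistxx.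
move=> [se te <- ch]; rewrite big_cons /=.
apply: (le_trans (tdist_triangle (chart e t) _ _)).
by rewrite lerD ?IH// tdist_chart// distrC.
Qed.

Lemma chain_cat c c' x y z : is_chain x c y -> is_chain y c' z ->
  is_chain x (c ++ c') z.
Proof.
by elim: c x => [x ->|[[e s] t] c IH x /= [se te <- ch] ch'] //=; split=> //; exact: IH.
Qed.

Lemma chain_exists x y : exists c, is_chain x c y.
Proof.
pose P z := `[< exists c, is_chain x c z >].
have : P y = P x.
  apply: constant_along_edges => e t te; apply/asboolP/asboolP => -[c ch].
    exists (c ++ [:: (e, t, 0)]); apply: (chain_cat ch) => /=.
    by rewrite te itv_src.
  exists (c ++ [:: (e, 0, t)]); apply: (chain_cat ch) => /=.
  by rewrite te itv_src.
by move=> Pyx; apply/asboolP; rewrite -/(P y) Pyx; apply/asboolP; exists [::].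
Qed.

Let lengths x y := [set chain_length c | c in [set c | is_chain x c y]].

Let lengths_inf x y : has_inf (lengths x y).
Proof.
split; first by have [c ch] := chain_exists x y; exists (chain_length c), c.
by exists (tdist x y) => _ [c ch <-]; exact: tdist_le_chain.
Qed.

Lemma tdist_le_dist x y : tdist x y <= dist x y.
Proof.
have [+ _] := lengths_inf x y => ne.
by apply: lb_le_inf => // _ [c ch <-]; exact: tdist_le_chain.
Qed.

(** [dist x] is 1-Lipschitz along every edge, so the decomposition of its
    increment over the edges bounds it by [tdist x]. *)
Lemma distE x y : dist x y = tdist x y.
Proof.
apply/le_anti; rewrite tdist_le_dist andbT.
have lip e s t : 0 <= s <= len e -> 0 <= t <= len e ->
    dist x (chart e t) <= dist x (chart e s) + `|s - t|.
  move=> se te; rewrite -lerBlDr; apply: lb_le_inf.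
    by have [] := lengths_inf x (chart e s).
  move=> _ [c ch <-]; rewrite lerBlDr.
  apply: ge_inf; first by have [] := lengths_inf x (chart e t).
  exists (c ++ [:: (e, s, t)]) => /=; first by apply: chain_cat ch _.
  by rewrite /chain_length big_cat big_seq1 /= distrC.
have dxx : dist x x <= 0.
  apply: ge_inf; first by have [] := lengths_inf x x.
  by exists [::] => //=; rewrite /chain_length big_nil.
have := increment_decomposition (dist x) x y => /eqP.
rewrite subr_eq => /eqP ->; rewrite -[leRHS]addr0 lerD//.
by apply: ler_sum => e _; rewrite lerBlDl lip// coord_itv.
Qed.

(** Along the edge containing [x] the distance to [y] is a convex function, so
    one can move from [x] to an end of that edge straight away from [y]. *)
Lemma extend_to_vertex x y :
  exists v, tdist (inl v) y = tdist (inl v) x + tdist x y.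
Proof.
have [e [t [te ->]]] := gpoint_chart x; have /andP[t0 tl] := te.
have l0 := ltW (len_gt0 e).
have e0 := itv_src e; have el := itv_tgt e.
have /andP[c0 cl] := coord_itv e y.
have [ct|tc] := leP (coord e y) t.
  exists (tgt e); rewrite -chart_len tdist_chart// !tdist_edge//.
  rewrite !ger0_norm ?subr_ge0 ?(le_trans ct)//; lra.
exists (src e); rewrite -chart0 tdist_chart// !tdist_edge//.
rewrite !ler0_norm; lra.
Qed.

Definition total_length : R := \sum_e len (e : edge G).

Lemma tdist_le_total x y : tdist x y <= total_length.
Proof.
apply: ler_sum => e _.
have /andP[x0 xl] := coord_itv e x; have /andP[y0 yl] := coord_itv e y.
by rewrite ler_norml; apply/andP; split; lra.
Qed.

(** As pairs of points extend to pairs of vertices, this is the diameter of the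
    graph. *)
Definition vertex_diameter : R :=
  \big[Num.max/0]_(ab : vertex G * vertex G) tdist (inl ab.1) (inl ab.2).

Lemma tdist_le_diameter x y : tdist x y <= vertex_diameter.
Proof.
have [v xv] := extend_to_vertex x y; have [w yw] := extend_to_vertex y (inl v).
have vw : tdist (inl w) (inl v) <= vertex_diameter.
  exact: (@le_bigmax _ _ _ 0 (fun ab : vertex G * vertex G =>
    tdist (inl ab.1) (inl ab.2)) (w, v)).
apply: le_trans vw; rewrite yw (tdistC y) xv.
by have := tdist_ge0 (inl w) y; have := tdist_ge0 (inl v) x; lra.
Qed.

Lemma diametralP v w : tdist (inl v) (inl w) = vertex_diameter ->
  diametral (inl v : gpoint G) (inl w).
Proof. by move=> vw x y; rewrite !distE vw tdist_le_diameter. Qed.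

Lemma diametral_vertices :
  exists v w, tdist (inl v) (inl w) = vertex_diameter.
Proof.
have /card_gt0P[v0 _] := vertex_inhabited G.
have [[v w] _ vw] := @eq_bigmax _ _ _ 0 (v0, v0) xpredT
  (fun ab : vertex G * vertex G => tdist (inl ab.1) (inl ab.2)) isT
  (fun ab _ => tdist_ge0 _ _).
by exists v, w.
Qed.

Lemma edge_exists : exists e : edge G, True.
Proof.
have /card_gt0P[v0 _] := vertex_inhabited G.
by have [e _] := gpoint_chart (inl v0); exists e.
Qed.

Lemma vertex_diameter_gt0 : 0 < vertex_diameter.
Proof.
have [e _] := edge_exists; have l0 := len_gt0 e.
apply: lt_le_trans (tdist_le_diameter (chart e 0) (chart e (len e))).
by rewrite tdist_chart ?itv_src ?itv_tgt// sub0r normrN gtr0_norm.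
Qed.

End TreeCoordinates.

(** * Topology of the graph *)

Lemma common_radius (R : realType) (T : finType) (P : T -> R -> Prop) :
  (forall i r s, s <= r -> P i r -> P i s) ->
  (forall i, exists2 r, 0 < r & P i r) -> exists2 r, 0 < r & forall i, P i r.
Proof.
move=> mono ex.
have [f fP] : {f : T -> R & forall i, 0 < f i /\ P i (f i)}.
  apply: (@choice T R (fun i r => 0 < r /\ P i r)) => i.
  by have [r r0 Pr] := ex i; exists r.
exists (\big[Num.min/1]_i f i).
  by elim/big_ind: _ => [|a b a0 b0|i _]; rewrite ?lt_min ?a0//; case: (fP i).
move=> i; have [_] := fP i; apply: mono.
exact: bigmin_le.
Qed.

Section GraphTopology.
Context {R : realType} (G : metric_graph R).
Implicit Types (e g : edge G) (v w : vertex G) (x y z : gpoint G) (t : R).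

Lemma chart_continuous e : continuous (@chart R G e).
Proof. by apply/continuousP => A; exact. Qed.

Lemma graph_continuous (T : topologicalType) (f : gpoint G -> T) :
  (forall e, continuous (f \o chart e)) -> continuous f.
Proof.
move=> fe; apply/continuousP => A oA; change (gopen (f @^-1` A)) => e.
by have /continuousP := fe e => /(_ A oA).
Qed.

Context (acyclicG : without_cycles G).

Lemma coord_chart_clamp e t :
  coord e (chart e t) = Num.max 0 (Num.min t (len e)).
Proof.
have l0 := len_gt0 e; have [t0|t0] := leP t 0.
  rewrite chart_le0// coord_src min_l ?max_l// ltW//.
  exact: le_lt_trans l0.
have [tl|tl] := leP (len e) t.
  by rewrite chart_ge_len// coord_tgt// max_r// ltW.
by rewrite coord_chart ?max_r// !ltW.
Qed.

Lemma coord_continuous e : continuous (coord e : gpoint G -> R).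
Proof.
apply: graph_continuous => g; have [->|ge] := eqVneq g e.
  have -> : (coord e \o chart e) = (fun t => Num.max 0 (Num.min t (len e))).
    by apply/funext => t; exact: coord_chart_clamp.
  move=> t; have cmin : {for t, continuous (fun s : R => Num.min s (len e))}.
    by apply: (@continuous_min R R id (cst (len e))); [exact: cvg_id|exact: cvg_cst].
  by apply: (@continuous_max R R (cst 0) (fun s => Num.min s (len e))) => //; exact: cvg_cst.
have -> : (coord e \o chart g) = (fun=> coord e (inl (src g))).
  by apply/funext => t; exact: coord_chart_other.
by move=> t; exact: cvg_cst.
Qed.

(** The hat function of slope [1 / r] at a vertex [v] increases by at most
    [tdist / r], so it is positive on the ball of radius [r]; and it vanishes
    off the star of radius [r], which lies in the neighbourhood. *)
Lemma nbhs_tdist x (A : set (gpoint G)) : nbhs x A ->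
  exists2 r, 0 < r & forall y, tdist x y < r -> A y.
Proof.
rewrite nbhsE => -[B [oB Bx] BA].
suff [r r0 rB] : exists2 r, 0 < r & forall y, tdist x y < r -> B y.
  by exists r => // y /rB; exact: BA.
have radius e t : B (chart e t) ->
    exists2 r, 0 < r & forall s, `|t - s| < r -> B (chart e s).
  move=> Bt; have /(_ Bt) : B (chart e t) -> nbhs t (chart e @^-1` B).
    by move=> _; apply: open_nbhs_nbhs; split=> //; exact: (oB e).
  by move=> /nbhs_ballP[r r0 rB]; exists r => // s ts; exact: rB.
case: x Bx => [v|[[e t] /= h]] Bx; last first.
  rewrite -(chart_inside h) in Bx *.
  have [r r0 rB] := radius _ _ Bx; have /andP[t0 tl] := h.
  exists (Num.min r (Num.min t (len e - t))).
    by rewrite !lt_min r0 t0 subr_gt0.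
  move=> y; rewrite !lt_min => /and3P[yr yt yl].
  have cy : `|t - coord e y| <= tdist (chart e t) y.
    rewrite tdist_edge// ?lerDl ?sumr_ge0//.
    by rewrite !ltW.
  have := le_lt_trans cy yr => /rB; rewrite chart_coord//.
  have := le_lt_trans cy yt; have := le_lt_trans cy yl.
  by rewrite !ltr_norml; lra.
have [r r0 rB] : exists2 r, 0 < r & forall e, [/\ r <= len e,
    src e = v -> forall s, `|s| < r -> B (chart e s) &
    tgt e = v -> forall s, `|len e - s| < r -> B (chart e s)].
  apply: common_radius => [e r s sr [rl Bs Bt]|e].
    split=> [|ev p ps|ev p ps]; first exact: le_trans rl.
      by apply: Bs => //; exact: lt_le_trans sr.
    by apply: Bt => //; exact: lt_le_trans sr.
  have [r1 r10 B1] : exists2 r, 0 < r &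
      src e = v -> forall s, `|s| < r -> B (chart e s).
    have [ev|ev] := eqVneq (src e) v; last by exists 1 => // /eqP; rewrite (negPf ev).
    have [|r r0 rB] := radius e 0; first by rewrite chart0 ev.
    by exists r => // _ s sr; apply: rB; rewrite sub0r normrN.
  have [r2 r20 B2] : exists2 r, 0 < r &
      tgt e = v -> forall s, `|len e - s| < r -> B (chart e s).
    have [ev|ev] := eqVneq (tgt e) v; last by exists 1 => // /eqP; rewrite (negPf ev).
    have [|r r0 rB] := radius e (len e); first by rewrite chart_len ev.
    by exists r => // _ s sr; apply: rB.
  exists (Num.min (len e) (Num.min r1 r2)); first by rewrite !lt_min len_gt0 r10.
  split; first by rewrite ge_min lexx.
    by move=> ev s; rewrite !lt_min => /and3P[_ sr _]; exact: B1.
  by move=> ev s; rewrite !lt_min => /and3P[_ _ sr]; exact: B2.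
exists r => // y vy.
pose hat e t : R := if src e == v then Num.max 0 (1 - t / r)
  else if tgt e == v then Num.max 0 (1 - (len e - t) / r) else 0.
pose h z : R := match z with
  | inl w => (w == v)%:R
  | inr z => hat (val z).1 (val z).2 end.
have max0 (p : R) : 1 <= p -> Num.max 0 (1 - p) = 0.
  by move=> p1; rewrite max_l// subr_le0.
have h_chart e t : 0 <= t <= len e -> h (chart e t) = hat e t.
  have [rl _ _] := rB e; have lr : 1 <= len e / r by rewrite ler_pdivlMr// mul1r.
  have st := loopless e.
  move=> /andP[]; rewrite le_eqVlt => /predU1P[<- _|t0].
    rewrite chart0 /= /hat; case: eqP => [ev|ev].
      by rewrite mul0r subr0 max_r.
    by case: eqP => // _; rewrite subr0 max0.
  rewrite le_eqVlt => /predU1P[->|tl].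
    rewrite chart_len /= /hat subrr mul0r subr0 max0// max_r//.
    move: st; have [->|_ _] := eqVneq (src e) v; last by case: eqP.
    by rewrite eq_sym => /negPf ->.
  by rewrite (@chart_inside _ _ e t) ?t0.
have max_lip (p q : R) : Num.max 0 p - Num.max 0 q <= `|p - q|.
  by have [|] := leP 0 p; have [|] := leP 0 q; have := ler_norm (p - q);
    have := normr_ge0 (p - q); lra.
have hat_lip e s t : hat e s - hat e t <= `|s - t| / r.
  have rr (p : R) : `|p / r| = `|p| / r.
    by rewrite normrM normfV [`|r|]gtr0_norm.
  rewrite /hat; case: ifP => _.
    apply: le_trans (max_lip _ _) _; rewrite -rr -normrN.
    by have -> : - (1 - s / r - (1 - t / r)) = (s - t) / r by ring.
  case: ifP => _; last by rewrite subrr divr_ge0 // ltW.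
  apply: le_trans (max_lip _ _) _; rewrite -rr.
  by have -> : 1 - (len e - s) / r - (1 - (len e - t) / r) = (s - t) / r by ring.
have hy : 0 < h y.
  have hv : h (inl v) - h y <= tdist (inl v) y / r.
    rewrite (increment_decomposition acyclicG h) /tdist mulr_suml.
    by apply: ler_sum => e _; rewrite !h_chart ?coord_itv// hat_lip.
  have : tdist (inl v) y / r < 1 by rewrite ltr_pdivrMr// mul1r.
  have hv1 : h (inl v) = 1 by rewrite /h eqxx.
  by move: hv; rewrite hv1; lra.
have [e [t [te yt]]] := gpoint_chart y.
move: hy; rewrite yt h_chart// /hat; have /andP[t0 tl] := te.
have [_ Bs Bt] := rB e.
case: eqP => [ev|_].
  rewrite lt_max ltxx /= subr_gt0 ltr_pdivrMr// mul1r => tr.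
  by apply: Bs => //; rewrite ger0_norm.
case: eqP => [ev|_]; last by rewrite ltxx.
rewrite lt_max ltxx /= subr_gt0 ltr_pdivrMr// mul1r => tr.
by apply: Bt => //; rewrite ger0_norm// subr_ge0.
Qed.

End GraphTopology.

(** * The path between two vertices *)

Section Paths.
Context {R : realType} (G : metric_graph R) (acyclicG : without_cycles G).
Implicit Types (e g : edge G) (x y z : gpoint G) (t : R).
Context (v w : vertex G).
Let a : gpoint G := inl v.
Let b : gpoint G := inl w.

(** [slope e] is [1], [-1] or [0], according to the direction in which the path
    from [v] to [w] runs along [e]. *)
Definition slope e : R := (coord e b - coord e a) / len e.

(** The position along the path of the projection of [x] onto it. *)
Definition pos x : R := \sum_e slope e * (coord e x - coord e a).

Definition geodesic : set (gpoint G) :=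
  [set x | forall e, coord e a = coord e b -> coord e x = coord e a].

Lemma slopeP e :
  [\/ coord e a = coord e b /\ slope e = 0,
      [/\ coord e a = 0, coord e b = len e & slope e = 1] |
      [/\ coord e a = len e, coord e b = 0 & slope e = -1]].
Proof.
have l0 : len e != 0 by rewrite gt_eqF ?len_gt0.
rewrite /slope /a /b; case: (coord_vertex e v) => ->;
  case: (coord_vertex e w) => ->; rewrite ?subrr ?mul0r ?subr0 ?sub0r.
- by constructor 1.
- by constructor 2; split; rewrite ?divff.
- by constructor 3; split; rewrite ?mulNr ?divff.
- by constructor 1.
Qed.

Lemma normr_slope e : `|slope e| <= 1.
Proof.
by case: (slopeP e) => -[]// => [_ ->|_ _ ->|_ _ ->];
  rewrite ?normr0 ?normrN ?normr1.
Qed.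

Lemma pos_src : pos a = 0.
Proof. by rewrite /pos big1// => e _; rewrite subrr mulr0. Qed.

Lemma pos_tgt : pos b = tdist a b.
Proof.
apply: eq_bigr => e _; have l0 := len_gt0 e.
case: (slopeP e) => -[] => [-> ->|-> -> ->|-> -> ->].
- by rewrite subrr mul0r normr0.
- by rewrite sub0r subr0 mul1r normrN gtr0_norm.
- by rewrite sub0r subr0 mulrNN mul1r gtr0_norm.
Qed.

Lemma pos_itv x : 0 <= pos x <= tdist a b.
Proof.
have term e : 0 <= slope e * (coord e x - coord e a) <= `|coord e a - coord e b|.
  have /andP[x0 xl] := coord_itv acyclicG e x; have l0 := len_gt0 e.
  case: (slopeP e) => -[].
  - by move=> -> ->; rewrite mul0r lexx normr_ge0.
  - move=> -> -> ->; rewrite sub0r normrN gtr0_norm//; lra.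
  - move=> -> -> ->; rewrite subr0 gtr0_norm//; lra.
by apply/andP; split; [apply: sumr_ge0 | apply: ler_sum] => e _;
  case/andP: (term e).
Qed.

Lemma posB x y : pos x - pos y = \sum_e slope e * (coord e x - coord e y).
Proof. by rewrite -sumrB; apply: eq_bigr => e _; ring. Qed.

Lemma pos_lip x y : `|pos x - pos y| <= tdist x y.
Proof.
rewrite posB; apply: (le_trans (ler_norm_sum _ _ _)); apply: ler_sum => e _.
by rewrite normrM ler_piMl ?normr_slope.
Qed.

Lemma pos_chart e t : 0 <= t <= len e ->
  pos (chart e t) = pos (chart e 0) + slope e * t.
Proof.
move=> te; rewrite -[LHS](subrK (pos (chart e 0))) addrC posB; congr (_ + _).
rewrite (bigD1 e)//= !coord_chart ?itv_src// subr0 big1 ?addr0// => g ge.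
by rewrite !(@coord_chart_other _ _ g e) 1?eq_sym// subrr mulr0.
Qed.

Lemma geodesic_edge e t : coord e a != coord e b -> geodesic (chart e t).
Proof.
move=> ab g gab; have [eg|eg] := eqVneq e g.
  by move: ab; rewrite eg gab eqxx.
rewrite coord_chart_other//.
have [ea|<-//] := coord_laminar a eg.
have [eb|] := coord_laminar b eg; last by rewrite -gab => <-.
by move: ab; rewrite ea eb eqxx.
Qed.

Lemma norm_sum_same_sign (I : finType) (F : I -> R) :
  (forall i j, 0 < F i -> F j < 0 -> False) -> `|\sum_i F i| = \sum_i `|F i|.
Proof.
move=> same; have [/existsP[i Fi]|/existsPn np] := boolP [exists i, 0 < F i].
  have F0 j : 0 <= F j by rewrite leNgt; apply/negP => /(same _ _ Fi).
  by rewrite ger0_norm ?sumr_ge0//; apply: eq_bigr => j _; rewrite ger0_norm.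
have F0 j : F j <= 0 by rewrite leNgt.
rewrite ler0_norm ?sumr_le0// -sumrN.
by apply: eq_bigr => j _; rewrite ler0_norm.
Qed.

(** Two points of the geodesic cannot advance along one edge and go back along
    another: by laminarity one of these edges comes before the other. *)
Lemma geodesic_tdist x y : geodesic x -> geodesic y ->
  tdist x y = `|pos x - pos y|.
Proof.
move=> Ux Uy; rewrite posB norm_sum_same_sign; last first.
  move=> e g pe ng.
  have eg : e != g by apply/eqP => eg; move: pe; rewrite eg ltNge ltW.
  have := coord_laminar x eg; have := coord_laminar y eg.
  have := coord_laminar a eg; have := coord_laminar b eg.
  have := coord_itv acyclicG e x; have := coord_itv acyclicG e y.
  have := coord_itv acyclicG g x; have := coord_itv acyclicG g y.
  move: pe ng; have := len_gt0 e; have := len_gt0 g.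
  (* For each pair of directions in which the path crosses [e] and [g], the
     alternatives of laminarity for [a], [b], [x] and [y] contradict the signs. *)
  case: (slopeP e) => -[] => [_ ->|-> -> ->|-> -> ->]; first lra.
    case: (slopeP g) => -[] => [_ ->|-> -> ->|-> -> ->]; first lra.
      by move=> ? ? ? ? ? ? ? ? [?|?] [?|?];
        first [lra | move=> [?|?]; first [lra | move=> [?|?]; lra]].
    by move=> ? ? ? ? ? ? ? ? [?|?] [?|?];
        first [lra | move=> [?|?]; first [lra | move=> [?|?]; lra]].
  case: (slopeP g) => -[] => [_ ->|-> -> ->|-> -> ->]; first lra.
    by move=> ? ? ? ? ? ? ? ? [?|?] [?|?];
        first [lra | move=> [?|?]; first [lra | move=> [?|?]; lra]].
  by move=> ? ? ? ? ? ? ? ? [?|?] [?|?];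
        first [lra | move=> [?|?]; first [lra | move=> [?|?]; lra]].
apply: eq_bigr => e _; rewrite normrM.
case: (slopeP e) => -[] => [ab ->|_ _ ->|_ _ ->].
- by rewrite (Ux e ab) (Uy e ab) subrr normr0 mulr0.
- by rewrite normr1 mul1r.
- by rewrite normrN normr1 mul1r.
Qed.

Lemma geodesic_src : geodesic a. Proof. by []. Qed.
Lemma geodesic_tgt : geodesic b. Proof. by move=> e ->. Qed.

(** If the position [c] were missed on the geodesic, then the truth value of
    [c < pos x] would be constant along every edge, on the geodesic or not. *)
Lemma geodesic_pos c : 0 <= c <= tdist a b -> exists2 x, geodesic x & pos x = c.
Proof.
move=> /andP[c0 cd]; apply: contrapT => nex.
have a0 := pos_src; have bd := pos_tgt.
have {}c0 : 0 < c.
  by rewrite lt_neqAle c0 andbT; apply/eqP => c00; apply: nex; exists a; rewrite ?a0.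
have {}cd : c < tdist a b.
  by rewrite lt_neqAle cd andbT; apply/eqP => c00; apply: nex; exists b; rewrite ?bd.
suff /eqP : (c < pos a) = (c < pos b).
  by rewrite a0 bd cd ltNge (ltW c0).
apply: (constant_along_edges (f := fun x => c < pos x)) => e t te.
have key s : 0 <= s <= len e -> coord e a != coord e b -> pos (chart e s) != c.
  by move=> se ab; apply/eqP => sc; apply: nex; exists (chart e s) => //;
    exact: geodesic_edge.
have := key (c - pos (chart e 0)); have := key (pos (chart e 0) - c).
have te' := te; move: te'; rewrite (pos_chart (t := t))//; have l0 := len_gt0 e.
case: (slopeP e) => -[].
- by move=> _ ->; rewrite mul0r addr0.
- move=> ea eb sl /andP[t0 tl] _ k; rewrite sl mul1r; apply/idP/idP; last by lra.
  move=> h1; rewrite ltNge; apply/negP => h2.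
  have h : 0 <= c - pos (chart e 0) <= len e by apply/andP; split; lra.
  have := k h; rewrite pos_chart// sl ea eb eq_sym (gt_eqF l0) => /(_ isT)/eqP.
  by apply; ring.
- move=> ea eb sl /andP[t0 tl] k _; rewrite sl mulN1r; apply/idP/idP; first by lra.
  move=> h1; rewrite ltNge; apply/negP => h2.
  have h : 0 <= pos (chart e 0) - c <= len e by apply/andP; split; lra.
  have := k h; rewrite pos_chart// sl ea eb (gt_eqF l0) => /(_ isT)/eqP.
  by apply; ring.
Qed.

Lemma pos_continuous : continuous pos.
Proof.
apply: graph_continuous => g.
suff cs (r : seq (edge G)) : continuous
    (fun t => \sum_(e <- r) slope e * (coord e (chart g t) - coord e a)) by exact: cs.
elim: r => [|e r IH] x.
  have -> : (fun t => \sum_(e <- [::]) slope e * (coord e (chart g t) - coord e a))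
      = fun=> 0 by apply/funext => y; rewrite big_nil.
  exact: cst_continuous.
have -> : (fun t => \sum_(i <- e :: r) slope i * (coord i (chart g t) - coord i a)) =
  fun t => slope e * (coord e (chart g t) - coord e a) +
    \sum_(i <- r) slope i * (coord i (chart g t) - coord i a).
  by apply/funext => y; rewrite big_cons.
apply: cvgD; last exact: IH.
apply: cvgM; first exact: cvg_cst.
apply: cvgB; last exact: cvg_cst.
apply: continuous_comp; first exact: chart_continuous.
exact: coord_continuous.
Qed.

(** A path from [a] to [b] that left the geodesic would run into an edge with
    [coord e a = coord e b] and back, meeting an inner point of it twice, against
    injectivity. So it stays on the geodesic, and it reaches each position there by
    the intermediate value theorem. *)
Lemma path_is_geodesic U : is_path a b U -> U = geodesic.
Proof.
move=> [gam [cgam igam gam0 gam1 ->]].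
have cf (f : gpoint G -> R) s t : continuous f -> 0 <= s <= 1 -> 0 <= t <= 1 ->
    {within `[s, t], continuous (f \o gam)}.
  move=> fc s01 t01.
  have sub : `[s, t] `<=` `[0, 1].
    move=> z; rewrite /= !in_itv /= => /andP[sz zt].
    by case/andP: s01; case/andP: t01 => *; apply/andP; split; lra.
  apply: (continuous_subspaceW sub); apply/subspace_continuousP => z z01.
  apply: cvg_comp; last exact: fc.
  by move/subspace_continuousP: cgam; exact.
have Ugam s : 0 <= s <= 1 -> geodesic (gam s).
  move=> s01 e eab; apply: contrapT => ne.
  have /andP[s0 s1] := s01; have l0 := len_gt0 e.
  have /andP[c0 cl] := coord_itv acyclicG e (gam s).
  pose m := (coord e a + coord e (gam s)) / 2.
  have ma : coord e a != coord e (gam s) by apply/eqP => ea; apply: ne.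
  have m0 : 0 < m < len e.
    by apply/andP; move: ma; rewrite neq_lt /m; case: (coord_vertex e v) => /= ->;
      case/orP => ?; split; lra.
  have z01 : 0 <= (0 : R) <= 1 by rewrite lexx ler01.
  have o01 : 0 <= (1 : R) <= 1 by rewrite lexx ler01.
  have ml : Num.min (coord e a) (coord e (gam s)) <= m <=
            Num.max (coord e a) (coord e (gam s)).
    by rewrite /m; have [|] := leP (coord e a) (coord e (gam s)); lra.
  have [p p0s pm] := @IVT R (coord e \o gam) 0 s m s0
    (cf _ _ _ (coord_continuous acyclicG (e := e)) z01 s01)
    ltac:(rewrite /= gam0; exact: ml).
  have [q qs1 qm] := @IVT R (coord e \o gam) s 1 m s1
    (cf _ _ _ (coord_continuous acyclicG (e := e)) s01 o01)
    ltac:(rewrite /= gam1 -eab minC maxC; exact: ml).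
  move: p0s qs1; rewrite !in_itv /= => /andP[p0 ps] /andP[qs q1].
  have pq : gam p = gam q.
    have gm r : coord e (gam r) = m -> gam r = chart e m.
      by move=> rm; rewrite -{1}(@chart_coord _ _ acyclicG e (gam r)) rm.
    by rewrite (gm p pm) (gm q qm).
  have pq' : p = q by apply: igam => //; rewrite in_itv /=; lra.
  have ps' : p = s by lra.
  have es : coord e (gam s) = m by rewrite -ps'.
  by clear pq; apply: ne; move: es; rewrite /m; lra.
apply/seteqP; split => [_ [s + <-]|x Ux] /=.
  by rewrite /= in_itv /=; exact: Ugam.
have /andP[x0 xd] := pos_itv x.
have [||s s01 sx] := @IVT R (pos \o gam) 0 1 (pos x) ler01.
- by apply: cf; rewrite ?lexx ?ler01//; exact: pos_continuous.
- by rewrite /= gam0 gam1 pos_src pos_tgt min_l ?max_r ?tdist_ge0// x0.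
exists s => //; apply: (@tdist_eq0 _ _ acyclicG).
rewrite geodesic_tdist//; last by apply: Ugam; move: s01; rewrite in_itv.
by rewrite [pos (gam s)]sx subrr normr0.
Qed.

Lemma geodesic_is_path : v != w -> is_path a b geodesic.
Proof.
move=> vw; pose d := tdist a b.
have d0 : 0 < d.
  rewrite lt_neqAle tdist_ge0 andbT eq_sym; apply/eqP => /(tdist_eq0 acyclicG).
  by move=> [] /eqP; rewrite (negPf vw).
pose gam s := xget a [set x | geodesic x /\ pos x = s * d].
have gamP s : 0 <= s <= 1 -> geodesic (gam s) /\ pos (gam s) = s * d.
  move=> /andP[s0 s1]; have [|x Ux xs] := @geodesic_pos (s * d).
    by rewrite mulr_ge0 ?ler_piMl// ltW.
  by rewrite /gam; case: xgetP => [z _ []//|/(_ x)]; case.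
have in01 s : s \in `[0, 1] -> 0 <= s <= 1 by rewrite in_itv.
exists gam; split.
- apply/subspace_continuousP => s /= /in01 s01 B /(nbhs_tdist acyclicG)[r r0 rB].
  apply/nbhs_ballP; exists (r / d) => /=; first exact: divr_gt0.
  move=> t /= st /in01 t01; apply: rB.
  have [Us ps] := gamP _ s01; have [Ut pt] := gamP _ t01.
  rewrite geodesic_tdist// ps pt -mulrBl normrM (gtr0_norm d0).
  by rewrite -ltr_pdivlMr.
- move=> s t /in01 s01 /in01 t01 st.
  have [_ ps] := gamP s s01; have [_ pt] := gamP t t01.
  have : s * d = t * d by rewrite -ps -pt st.
  by apply: mulIf; rewrite gt_eqF.
- have [U0 p0] : geodesic (gam 0) /\ pos (gam 0) = 0 * d.
    by apply: gamP; rewrite lexx ler01.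
  apply: (@tdist_eq0 _ _ acyclicG); rewrite geodesic_tdist//.
  by rewrite p0 pos_src mul0r subrr normr0.
- have [U1 p1] : geodesic (gam 1) /\ pos (gam 1) = 1 * d.
    by apply: gamP; rewrite lexx ler01.
  apply: (@tdist_eq0 _ _ acyclicG); rewrite (geodesic_tdist U1 geodesic_tgt).
  by rewrite p1 pos_tgt mul1r subrr normr0.
- apply/seteqP; split => [x Ux|_ [s + <-]]; last by rewrite /= in_itv => /gamP[].
  have /andP[x0 xd] := pos_itv x.
  have s01 : 0 <= pos x / d <= 1.
    by rewrite divr_ge0 ?(ltW d0)// ler_pdivrMr// mul1r.
  exists (pos x / d); first by rewrite /= in_itv.
  have [Us ps] := gamP _ s01.
  apply: (@tdist_eq0 _ _ acyclicG); rewrite geodesic_tdist// ps divfK ?gt_eqF//.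
  by rewrite subrr normr0.
Qed.

(** An edge of the path whose coordinate takes two values on a connected set
    meets that set in an inner point, which is on the path. *)
Lemma pos_component x y : connected_component (~` geodesic) x y -> pos x = pos y.
Proof.
move=> [C [Cx CU Cc] Cy]; apply: eq_bigr => e _.
have [ab|ab] := eqVneq (coord e a) (coord e b).
  have -> : slope e = 0 by rewrite /slope ab subrr mul0r.
  by rewrite !mul0r.
suff -> : coord e x = coord e y by [].
have /connected_intervalP itv : connected (coord e @` C).
  apply: connected_continuous_connected => //.
  exact/continuous_subspaceT/coord_continuous.
have := coord_itv acyclicG e x; have := coord_itv acyclicG e y.
have mid p q : C p -> C q -> coord e p < coord e q -> False.
  move=> Cp Cq pq; have l0 := len_gt0 e.
  have := coord_itv acyclicG e p; have := coord_itv acyclicG e q.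
  move=> /andP[q0 ql] /andP[p0 pl].
  have Ip : (coord e @` C) (coord e p) by exists p.
  have Iq : (coord e @` C) (coord e q) by exists q.
  have [|] := itv _ _ Ip Iq ((coord e p + coord e q) / 2).
    by apply/andP; split; lra.
  move=> z Cz ez; apply: (CU z Cz).
  by rewrite /= -(@chart_coord _ _ acyclicG e z); [exact: geodesic_edge|lra].
by move=> _ _; have [/mid|/mid|//] := ltgtP (coord e x) (coord e y); case.
Qed.

End Paths.

(** * Square-integrable functions on an interval *)

Section Interval.
Context {R : realType}.
Local Notation mu := (@lebesgue_measure R).
Implicit Types (f g F : R -> R) (l s t x y : R).

Definition integr l f : Prop := mu.-integrable `]0, l[ (EFin \o f).
Definition integ l f : R := \int[mu]_(x in `]0, l[) f x.

Lemma measure_itvoo l : 0 < l -> mu `]0, l[ = l%:E.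
Proof. by move=> l0; rewrite lebesgue_measure_itv/= lte_fin l0 oppr0 adde0. Qed.

Lemma integ_cst l (c : R) : 0 < l -> integ l (fun=> c) = c * l.
Proof. by move=> l0; rewrite /integ Rintegral_cst// [X in fine X]measure_itvoo. Qed.

Lemma continuous_integr l f : {in `[0, l], continuous f} -> integr l f.
Proof.
move=> cf; have : mu.-integrable `[0, l] (EFin \o f).
  apply: continuous_compact_integrable; first exact: segment_compact.
  by apply: continuous_in_subspaceT => x; rewrite inE => /cf.
by apply: integrableS => //; exact: subset_itv_oo_cc.
Qed.

Lemma integrZ l (c : R) f : integr l f -> integr l (fun x => c * f x).
Proof.
move=> fi.
by have := @integrableZl _ _ R mu _ (measurable_itv _) c _ fi; apply: eq_integrable.
Qed.

Lemma integrD l f g : integr l f -> integr l g -> integr l (fun x => f x + g x).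
Proof.
move=> fi gi.
by have := @integrableD _ _ R mu _ (measurable_itv _) _ _ fi gi; apply: eq_integrable.
Qed.

Lemma integrB l f g : integr l f -> integr l g -> integr l (fun x => f x - g x).
Proof.
move=> fi gi.
by have := @integrableB _ _ R mu _ (measurable_itv _) _ _ fi gi; apply: eq_integrable.
Qed.

Lemma integZ l (c : R) f : integr l f -> integ l (fun x => c * f x) = c * integ l f.
Proof. by move=> fi; rewrite /integ RintegralZl. Qed.

Lemma integD l f g : integr l f -> integr l g ->
  integ l (fun x => f x + g x) = integ l f + integ l g.
Proof. by move=> fi gi; rewrite /integ RintegralD. Qed.

Lemma integB l f g : integr l f -> integr l g ->
  integ l (fun x => f x - g x) = integ l f - integ l g.
Proof. by move=> fi gi; rewrite /integ RintegralB. Qed.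

Lemma le_integ l f g : integr l f -> integr l g ->
  (forall x, 0 < x < l -> f x <= g x) -> integ l f <= integ l g.
Proof.
by move=> fi gi fg; apply: le_Rintegral => // x; rewrite /= in_itv; exact: fg.
Qed.

Lemma integ_ge0 l f : (forall x, 0 < x < l -> 0 <= f x) -> 0 <= integ l f.
Proof. by move=> f0; apply: Rintegral_ge0 => x; rewrite /= in_itv; exact: f0. Qed.

Lemma eq_integ l f g : (forall x, 0 < x < l -> f x = g x) -> integ l f = integ l g.
Proof.
by move=> fg; apply: eq_Rintegral => x; rewrite inE/= in_itv; exact: fg.
Qed.

Lemma le_integr l f g : measurable_fun `]0, l[ f -> integr l g ->
  (forall x, `|f x| <= g x) -> integr l f.
Proof.
move=> mf gi fg; apply: (le_integrable _ _ _ gi) => //.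
  exact/measurable_EFinP.
move=> x _; rewrite /= lee_fin (le_trans (fg x))//.
exact: ler_norm.
Qed.

(** The fundamental theorem of calculus. *)
Lemma integ_derive (a b : R) F f : a < b ->
  {in `[a, b], continuous F} -> {in `[a, b], continuous f} ->
  (forall x, a < x < b -> is_derive x 1 F (f x)) ->
  \int[mu]_(x in `]a, b[) f x = F b - F a.
Proof.
move=> ab cF cf dF.
have cf' : {within `[a, b], continuous f}.
  by apply: continuous_in_subspaceT => x; rewrite inE => /cf.
have fi : mu.-integrable `[a, b] (EFin \o f).
  by apply: continuous_compact_integrable => //; exact: segment_compact.
rewrite Rintegral_itv_bndo_bndc; last first.
  by apply: integrableS fi => //; exact: subset_itv_oo_cc.
rewrite Rintegral_itv_obnd_cbnd; last first.
  by apply: integrableS fi => //; exact: subset_itv_oc_cc.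
rewrite /Rintegral (@continuous_FTC2 _ f F)//.
- have cF' : {within `[a, b], continuous F}.
    by apply: continuous_in_subspaceT => x; rewrite inE => /cF.
  have /continuous_within_itvP [//|_ Fa Fb] := cF'.
  by split=> // x; rewrite in_itv => /dF [].
- by move=> x; rewrite in_itv => /dF [d <-]; rewrite derive1E.
Qed.

Lemma sqi_integr2 l g : square_integrable l g -> integr l (fun x => g x ^+ 2).
Proof. by case. Qed.

Lemma sqi_measurable l g : square_integrable l g -> measurable_fun `]0, l[ g.
Proof. by case. Qed.

Lemma sqiM l g g' : square_integrable l g -> square_integrable l g' ->
  integr l (fun x => g x * g' x).
Proof.
move=> gi gi'; apply: (le_integr _ (integrD (sqi_integr2 gi) (sqi_integr2 gi'))).
  by apply: measurable_funM; exact: sqi_measurable.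
move=> x; rewrite normrM -(real_normK (num_real (g x))) -(real_normK (num_real (g' x))).
have := sqr_ge0 (`|g x| - `|g' x|).
by have := normr_ge0 (g x); have := normr_ge0 (g' x); nra.
Qed.

Lemma continuous_sqi l f : {in `[0, l], continuous f} -> square_integrable l f.
Proof.
move=> cf; split; last first.
  by apply: continuous_integr => x xl; apply: (@continuousM _ _ f f); exact: cf.
by have /measurable_int/measurable_EFinP := continuous_integr cf.
Qed.

Lemma sqi_integr l g : square_integrable l g -> integr l g.
Proof.
move=> gi; have := sqiM gi (@continuous_sqi l (fun=> 1) _).
have -> : (fun x => g x * 1) = g by apply/funext => x; rewrite mulr1.
by apply=> x _; exact: cvg_cst.
Qed.

Lemma sqi_lin l (a b : R) g g' : square_integrable l g -> square_integrable l g' ->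
  square_integrable l (fun x => a * g x + b * g' x).
Proof.
move=> gi gi'; split.
  apply: measurable_funD; apply: measurable_funM => //; exact: sqi_measurable.
have -> : (fun x => ((a * g x + b * g' x) ^+ 2)%:E) = EFin \o (fun x =>
    a ^+ 2 * g x ^+ 2 + ((2 * a * b) * (g x * g' x) + b ^+ 2 * g' x ^+ 2)).
  by apply/funext => x /=; congr EFin; ring.
by apply: integrD; [|apply: integrD]; apply: integrZ;
  [exact: sqi_integr2|exact: sqiM|exact: sqi_integr2].
Qed.

Lemma test_function_derive l phi : test_function l phi -> forall x, is_derive x 1 phi (derive1 phi x).
Proof. by move=> [d _ _] x; rewrite derive1E; apply: DeriveDef. Qed.

Lemma test_function_continuous l phi : test_function l phi -> continuous phi.
Proof.
by move=> [d _ _] x; apply: differentiable_continuous; exact/derivable1_diffP.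
Qed.

Lemma test_function_ends l phi : test_function l phi -> phi 0 = 0 /\ phi l = 0.
Proof.
move=> [_ _ [a [b [a0 bl supp]]]]; split; apply: supp; rewrite in_itv /= negb_and -!ltNge.
  by rewrite a0.
by rewrite bl orbT.
Qed.

(** * Weak derivatives *)

Lemma weak_derivative_lin l (a b : R) f f' g g' :
  square_integrable l f -> square_integrable l f' ->
  square_integrable l g -> square_integrable l g' ->
  is_weak_derivative l f g -> is_weak_derivative l f' g' ->
  is_weak_derivative l (fun x => a * f x + b * f' x) (fun x => a * g x + b * g' x).
Proof.
move=> fi fi' gi gi' fg fg' phi tphi.
have dphi : square_integrable l (derive1 phi).
  by apply: continuous_sqi => x _; case: tphi => _ + _; exact.
have cphi : square_integrable l phi.
  by apply: continuous_sqi => x _; exact: (test_function_continuous tphi).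
have lin (p q r : R -> R) : square_integrable l p -> square_integrable l q ->
    square_integrable l r ->
    integ l (fun x => (a * p x + b * q x) * r x) =
    a * integ l (fun x => p x * r x) + b * integ l (fun x => q x * r x).
  move=> pi qi ri; rewrite -!integZ; try exact: sqiM.
  rewrite -integD; try by apply: integrZ; exact: sqiM.
  by apply: eq_integ => x _; ring.
rewrite -[LHS]/(integ l _) -[X in - X]/(integ l _) !lin//.
by rewrite /integ fg// fg'//; ring.
Qed.

(** Integration by parts; a test function vanishes at both ends. *)
Lemma weak_derivative_C1 l f g : 0 < l ->
  {in `[0, l], continuous f} -> {in `[0, l], continuous g} ->
  (forall x, 0 < x < l -> is_derive x 1 f (g x)) -> is_weak_derivative l f g.
Proof.
move=> l0 cf cg df phi tphi; have [phi0 phil] := test_function_ends tphi.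
have cphi := test_function_continuous tphi; have [_ cphi' _] := tphi.
have i1 : integr l (fun x => f x * derive1 phi x).
  by apply: continuous_integr => x xl; apply: continuousM; [exact: cf|exact: cphi'].
have i2 : integr l (fun x => g x * phi x).
  by apply: continuous_integr => x xl; apply: continuousM; [exact: cg|exact: cphi].
apply/eqP; rewrite -subr_eq0 opprK -[X in X + _]/(integ l _) -[X in _ + X]/(integ l _).
rewrite -integD//.
have -> : integ l (fun x => f x * derive1 phi x + g x * phi x) =
    f l * phi l - f 0 * phi 0.
  apply: (@integ_derive 0 l (fun x => f x * phi x)) => //.
  - by move=> x xl; apply: continuousM; [exact: cf|exact: cphi].
  - by move=> x xl; apply: cvgD; apply: continuousM;
      [exact: cf|exact: cphi'|exact: cg|exact: cphi].
  move=> x xl; have d1 := df x xl; have d2 := test_function_derive tphi x.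
  by apply: is_derive_eq; rewrite /GRing.scale/=; ring.
by rewrite /= phi0 phil !mulr0 subrr.
Qed.

Lemma is_derive_quadratic F x (d C : R) :
  (forall h, `|F (x + h) - F x - d * h| <= C * h ^+ 2) -> is_derive x 1 F d.
Proof.
move=> H; have key : h^-1 *: (F (h *: 1 + x) - F x) @[h --> 0^'] --> d.
  apply/cvgrPdist_le => e e0.
  near=> h.
  have h0 : h != 0 by near: h; exact: nbhs_dnbhs_neq.
  have hn : 0 < `|h| by rewrite normr_gt0.
  have -> : d - h^-1 *: (F (h *: 1 + x) - F x) = - (h^-1 * (F (x + h) - F x - d * h)).
    by rewrite /GRing.scale/= mulr1 (addrC h); field.
  rewrite normrN normrM normfV mulrC ler_pdivrMr//.
  apply: (le_trans (H h)); rewrite -(real_normK (num_real h)) expr2 mulrA ler_pM2r//.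
  have hd : `|h| <= e / (`|C| + 1).
    by near: h; apply: dnbhs0_le; rewrite divr_gt0// ltr_wpDl.
  have C1 : 0 < `|C| + 1 by rewrite ltr_wpDl.
  move: hd; rewrite ler_pdivlMr// => hd.
  have := ler_norm C; nra.
by split; [apply/cvg_ex; exists d|exact: (cvg_lim _ key)].
Unshelve. all: by end_near. Qed.

(** The steps below are second differences of the function [max(0, y) ^ 2],
    which is continuously differentiable but not of class C^2. *)
Definition posq y : R := Num.max 0 y ^+ 2.

Lemma posq_derive (y : R) : is_derive y 1 posq (2 * Num.max 0 y).
Proof.
apply: (@is_derive_quadratic _ _ _ 1) => h; rewrite /posq mul1r ler_norml.
by have [|] := leP 0 y; have [|] := leP 0 (y + h) => *; apply/andP; split; nra.
Qed.

Definition bump s h x : R := 4 / h ^+ 2 *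
  (Num.max 0 (x - s) - 2 * Num.max 0 (x - s - h / 2) + Num.max 0 (x - s - h)).

(** A step of class C^1, which is [0] before [s] and [1] after [s + h]. *)
Definition step s h x : R := 2 / h ^+ 2 *
  (posq (x - s) - 2 * posq (x - s - h / 2) + posq (x - s - h)).

Lemma step_derive (s h x : R) : is_derive x 1 (step s h) (bump s h x).
Proof.
have shift c : is_derive x 1 (fun x => posq (x - c)) (2 * Num.max 0 (x - c)).
  have d : is_derive x 1 (fun x : R => x - c) 1.
    by apply: is_derive_eq; rewrite subr0.
  have dp := posq_derive (x - c).
  by have := @is_derive1_comp R posq (fun x : R => x - c) x _ _ dp d; rewrite mulr1.
have d0 := shift s; have d1 := shift (s + h / 2); have d2 := shift (s + h).
have -> : step s h = fun x => 2 / h ^+ 2 *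
  (posq (x - s) - 2 * posq (x - (s + h / 2)) + posq (x - (s + h))).
  by apply/funext => y; rewrite /step !opprD !addrA.
apply: is_derive_eq; rewrite /bump !opprD !addrA /GRing.scale /=.
by ring.
Qed.

Lemma bump_continuous s h : continuous (bump s h).
Proof.
have shift c : continuous (fun x : R => Num.max 0 (x - c)).
  move=> x; apply: (@continuous_max R R (cst 0) (fun x => x - c)); first exact: cvg_cst.
  by apply: cvgB; [exact: cvg_id|exact: cvg_cst].
have -> : bump s h = fun x => 4 / h ^+ 2 * (Num.max 0 (x - s) -
    2 * Num.max 0 (x - (s + h / 2)) + Num.max 0 (x - (s + h))).
  by apply/funext => y; rewrite /bump !opprD !addrA.
move=> x; apply: cvgM; first exact: cvg_cst.
apply: cvgD; last exact: shift.
apply: cvgB; first exact: shift.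
by apply: cvgM; [exact: cvg_cst|exact: shift].
Qed.

Lemma step_continuous s h : continuous (step s h).
Proof.
move=> x; have [d _] := step_derive s h x.
by apply: differentiable_continuous; exact/derivable1_diffP.
Qed.

Lemma derive1_step s h : derive1 (step s h) = bump s h.
Proof.
by apply/funext => x; have [_] := step_derive s h x; rewrite derive1E => ->.
Qed.

Section step_values.
Context (s h : R) (h_gt0 : 0 < h).

Lemma bump_ge0 x : 0 <= bump s h x.
Proof.
apply: mulr_ge0; first by rewrite divr_ge0// sqr_ge0.
by have [|] := leP 0 (x - s); have [|] := leP 0 (x - s - h / 2);
  have [|] := leP 0 (x - s - h); lra.
Qed.

Lemma bump_off x : (x <= s) || (s + h <= x) -> bump s h x = 0.
Proof.
have h0 := h_gt0; move=> xs; rewrite /bump; suff -> : Num.max 0 (x - s) -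
  2 * Num.max 0 (x - s - h / 2) + Num.max 0 (x - s - h) = 0 by rewrite mulr0.
by move: xs => /orP[] xs; have [|] := leP 0 (x - s); have [|] := leP 0 (x - s - h / 2);
  have [|] := leP 0 (x - s - h); lra.
Qed.

Lemma step_before x : x <= s -> step s h x = 0.
Proof.
have h0 := h_gt0; move=> xs; rewrite /step /posq !max_l; by [lra|rewrite expr0n /=; ring].
Qed.

Lemma step_after x : s + h <= x -> step s h x = 1.
Proof.
have h0 := h_gt0; move=> xs; rewrite /step /posq !max_r; try lra.
by field; rewrite gt_eqF.
Qed.

Lemma step_homo x y : x <= y -> step s h x <= step s h y.
Proof.
move=> xy.
have d z : z \in `]x, y[ -> derivable (step s h) z 1.
  by move=> _; have [] := step_derive s h z.
have d0 z : z \in `]x, y[ -> 0 <= derive1 (step s h) z.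
  by move=> _; rewrite derive1_step bump_ge0.
have c : {within `[x, y], continuous (step s h)}.
  by apply: continuous_subspaceT => z; exact: step_continuous.
exact: (ger0_derive1_ndecr d d0 c (lexx x) xy (lexx y)).
Qed.

Lemma step_itv x : 0 <= step s h x <= 1.
Proof.
apply/andP; split.
  have [xs|sx] := leP x s; first by rewrite step_before.
  by rewrite -(step_before (lexx s)) step_homo// ltW.
have [xs|sx] := leP (s + h) x; first by rewrite step_after.
by rewrite -(step_after (lexx (s + h))) step_homo// ltW.
Qed.

(** A bump has integral [1], so the integral on the left is a weighted mean of [f]
    over [[s, s + h]]. *)
Lemma integ_bump l f e : {in `[0, l], continuous f} -> 0 < s -> s + h < l ->
  forall c, (forall x, s <= x <= s + h -> `|f x - c| <= e) ->
  `|integ l (fun x => f x * bump s h x) - c| <= e.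
Proof.
have h0 := h_gt0; move=> cf s0 sl c fc; have l0 : 0 < l by lra.
have cb : {in `[0, l], continuous (bump s h)} by move=> x _; exact: bump_continuous.
have ib : integ l (bump s h) = 1.
  have -> : 1 = step s h l - step s h 0.
    by rewrite step_after ?(ltW sl)// step_before ?subr0// ltW.
  apply: (@integ_derive 0 l (step s h) (bump s h) l0).
  - by move=> x _; exact: step_continuous.
  - exact: cb.
  - by move=> x _; exact: step_derive.
have i1 : integr l (fun x => f x * bump s h x).
  by apply: continuous_integr => x xl; apply: continuousM; [exact: cf|exact: cb].
have ibi := continuous_integr cb.
have -> : integ l (fun x => f x * bump s h x) - c =
    integ l (fun x => f x * bump s h x - c * bump s h x).
  by rewrite (integB i1 (integrZ c ibi)) (integZ c ibi) ib mulr1.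
have bd x : - e * bump s h x <= f x * bump s h x - c * bump s h x <= e * bump s h x.
  rewrite -mulrBl; have [off|/norP[]] := boolP ((x <= s) || (s + h <= x)).
    by rewrite bump_off// !mulr0 lexx.
  rewrite -!ltNge => x1 x2; have /fc : s <= x <= s + h by rewrite !ltW.
  by rewrite ler_norml => /andP[f1 f2]; rewrite !ler_wpM2r// bump_ge0.
rewrite ler_norml; apply/andP; split.
  have -> : - e = integ l (fun x => - e * bump s h x) by rewrite integZ// ib mulr1.
  by apply: le_integ => [||x _]; [exact: integrZ|apply: integrB => //; exact: integrZ|];
    case/andP: (bd x).
have -> : e = integ l (fun x => e * bump s h x) by rewrite integZ// ib mulr1.
by apply: le_integ => [||x _]; [apply: integrB => //; exact: integrZ|exact: integrZ|];
  case/andP: (bd x).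
Qed.

End step_values.

Lemma integ_indic l s t : 0 <= s -> s <= t -> t <= l ->
  integr l (\1_(`]s, t[ : set R) : R -> R) /\ integ l \1_(`]s, t[ : set R) = t - s.
Proof.
move=> s0 st tl; have sub : `]s, t[ `<=` `]0, l[.
  by move=> x; rewrite /= !in_itv /= => /andP[sx xt]; apply/andP; split; lra.
split; first by apply: integrableS (integrable_indic_itv s t false true).
rewrite /integ /Rintegral integral_indic// setIidl//.
have [->|st'] := eqVneq s t; first by rewrite set_itvoo0 ?measure0 ?subrr.
by rewrite [X in fine X]lebesgue_measure_itv/= lte_fin lt_neqAle st' st.
Qed.

(** A nonnegative quadratic polynomial in [lam] has a nonpositive discriminant. *)
Lemma discriminant (X A T : R) : 0 <= A -> 0 <= T ->
  (forall lam, 2 * lam * X <= lam ^+ 2 * A + T) -> X ^+ 2 <= T * A.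
Proof.
move=> A0 T0 H; have [A_eq0|A_neq0] := eqVneq A 0.
  have [->|X0] := eqVneq X 0; first by rewrite expr0n mulr_ge0.
  have := H ((T + 1) / X); rewrite A_eq0 mulr0 add0r.
  by have -> : 2 * ((T + 1) / X) * X = 2 * (T + 1) by [field]; lra.
have {A_neq0}A0 : 0 < A by rewrite lt_neqAle eq_sym A_neq0.
have := H (X / A).
have -> : 2 * (X / A) * X = 2 * (X ^+ 2 / A) by field; rewrite gt_eqF.
have -> : (X / A) ^+ 2 * A = X ^+ 2 / A by field; rewrite gt_eqF.
by rewrite -(ler_pdivrMr _ _ A0); lra.
Qed.

(** A test function which is [1] on [[s + d, t - d]] and [0] off [[s, t]]. *)
Definition plateau s t d x : R := step (s + d / 2) (d / 2) x - step (t - d) (d / 2) x.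

Section plateau_values.
Context (l s t d : R) (s_ge0 : 0 <= s) (t_le : t <= l) (d_gt0 : 0 < d)
  (d_small : 3 * d <= t - s).

Let d2_gt0 : 0 < d / 2. Proof. exact: divr_gt0. Qed.

Lemma plateau_off x : x \notin `[s + d / 2, t - d / 2] -> plateau s t d x = 0.
Proof.
have := d_small; have := d_gt0 => d0 ds.
rewrite in_itv /= negb_and -!ltNge => /orP[] xs; rewrite /plateau.
  by rewrite !(step_before d2_gt0) ?subrr//; lra.
by rewrite !(step_after d2_gt0) ?subrr//; lra.
Qed.

Lemma plateau_on x : s + d <= x <= t - d -> plateau s t d x = 1.
Proof.
have := d_small; have := d_gt0 => d0 ds /andP[sx xt]; rewrite /plateau.
by rewrite (step_after d2_gt0) ?(step_before d2_gt0) ?subr0//; lra.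
Qed.

Lemma plateau_itv x : 0 <= plateau s t d x <= 1.
Proof.
have := d_small; have := d_gt0 => d0 ds; rewrite /plateau.
have /andP[a0 a1] := step_itv (s + d / 2) d2_gt0 x.
have /andP[b0 b1] := step_itv (t - d) d2_gt0 x.
apply/andP; split; last lra.
have [xt|tx] := leP x (t - d); first by rewrite (step_before d2_gt0 xt) subr0.
by rewrite (@step_after (s + d / 2) _ d2_gt0 x) ?subr_ge0//; lra.
Qed.

Lemma plateau_derive x :
  is_derive x 1 (plateau s t d) (bump (s + d / 2) (d / 2) x - bump (t - d) (d / 2) x).
Proof.
have := step_derive (s + d / 2) (d / 2) x; have := step_derive (t - d) (d / 2) x.
by move=> d1 d2'; rewrite /plateau; apply: is_derive_eq.
Qed.

Lemma derive1_plateau : derive1 (plateau s t d) =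
  fun x => bump (s + d / 2) (d / 2) x - bump (t - d) (d / 2) x.
Proof.
by apply/funext => x; have [_] := plateau_derive x; rewrite derive1E => ->.
Qed.

Lemma plateau_test : test_function l (plateau s t d).
Proof.
split.
- by move=> x; have [] := plateau_derive x.
- rewrite derive1_plateau => x; apply: cvgB; exact: bump_continuous.
- exists (s + d / 2), (t - d / 2); have := d_gt0; have := s_ge0; have := t_le.
  split; [lra|lra|exact: plateau_off].
Qed.

Lemma plateau_le_indic x : plateau s t d x <= \1_(`]s, t[ : set R) x.
Proof.
have := d_gt0 => d0; rewrite indicE; have /andP[p0 p1] := plateau_itv x.
have [//|xn] := boolP (x \in _); rewrite plateau_off//.
apply: contra xn; rewrite inE /= !in_itv /= => /andP[sx xt].
by apply/andP; split; lra.
Qed.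

End plateau_values.

(** The Cauchy-Schwarz inequality for the increments of [f], with a free
    parameter [lam] that allows summation over the edges of a graph. The weak
    derivative is tested on a plateau, which tends to the indicator of [[s, t]]. *)
Lemma weak_increment l f g s t lam : square_integrable l g ->
  is_weak_derivative l f g -> {in `[0, l], continuous f} ->
  0 <= s -> s <= t -> t <= l ->
  2 * lam * (f t - f s) <= lam ^+ 2 * integ l (fun x => g x ^+ 2) + (t - s).
Proof.
move=> gi fg cf s0; rewrite le_eqVlt => /predU1P[<- _|st tl].
  rewrite !subrr mulr0 addr0 mulr_ge0 ?sqr_ge0//.
  by apply: integ_ge0 => x _; exact: sqr_ge0.
apply/ler_addgt0Pr => e e0.
pose e' := e / (4 * (`|lam| + 1)).
have lam1 : 0 < `|lam| + 1 by rewrite ltr_wpDl.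
have e'0 : 0 < e' by rewrite divr_gt0// mulr_gt0.
have near_pt y : 0 <= y <= l ->
    exists2 d, 0 < d & forall x, `|y - x| < d -> `|f x - f y| <= e'.
  move=> yl; have /cvgrPdist_le/(_ e' e'0) := cf y ltac:(by rewrite in_itv).
  by move=> /nbhs_ballP[d d0 H]; exists d => // x /H; rewrite distrC.
have [|d1 d10 fs] := near_pt s; first by apply/andP; split; lra.
have [|d2 d20 ft] := near_pt t; first by apply/andP; split; lra.
pose d := Num.min ((t - s) / 3) (Num.min (d1 / 2) (d2 / 2)).
have d0 : 0 < d by rewrite !lt_min !divr_gt0// subr_gt0.
have ds : 3 * d <= t - s by rewrite mulrC -ler_pdivlMr// ge_min lexx.
have dd1 : d < d1 by rewrite !gt_min; apply/orP; right; apply/orP; left; lra.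
have dd2 : d < d2 by rewrite !gt_min; apply/orP; right; apply/orP; right; lra.
pose phi := plateau s t d.
have tphi : test_function l phi := plateau_test s0 tl d0 ds.
have cphi : {in `[0, l], continuous phi}.
  by move=> x _; exact: (test_function_continuous tphi).
have cb a b : {in `[0, l], continuous (fun x => f x * bump a b x)}.
  by move=> x xl; apply: continuousM; [exact: cf|exact: bump_continuous].
have := fg phi tphi; rewrite /phi derive1_plateau.
have -> : \int[mu]_(x in `]0, l[) (f x * (bump (s + d / 2) (d / 2) x -
      bump (t - d) (d / 2) x)) =
    integ l (fun x => f x * bump (s + d / 2) (d / 2) x) -
    integ l (fun x => f x * bump (t - d) (d / 2) x).
  rewrite -integB; try exact: continuous_integr.
  by apply: eq_integ => x _; rewrite mulrBr.
rewrite -/phi -[X in _ = - X]/(integ l (fun x => g x * phi x)) => by_parts.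
have d20' : 0 < d / 2 by rewrite divr_gt0.
have sd0 : 0 < s + d / 2 by clear -s0 d20'; lra.
have td0 : 0 < t - d by clear -s0 ds d0; lra.
have sdl : s + d / 2 + d / 2 < l by clear -st tl ds d0; lra.
have tdl : t - d + d / 2 < l by clear -tl d0; lra.
have := @integ_bump (s + d / 2) (d / 2) d20' l f e' cf _ _ (f s) _.
move=> /(_ sd0 sdl) bs.
have {}bs : `|integ l (fun x => f x * bump (s + d / 2) (d / 2) x) - f s| <= e'.
  apply: bs => x /andP[x1 x2]; apply: fs; rewrite ltr_norml; lra.
have := @integ_bump (t - d) (d / 2) d20' l f e' cf _ _ (f t) _.
move=> /(_ td0 tdl) bt.
have {}bt : `|integ l (fun x => f x * bump (t - d) (d / 2) x) - f t| <= e'.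
  apply: bt => x /andP[x1 x2]; apply: ft; rewrite ltr_norml; lra.
have gphi : 2 * lam * integ l (fun x => g x * phi x) <=
    lam ^+ 2 * integ l (fun x => g x ^+ 2) + (t - s).
  have [ind_i ind_v] := integ_indic s0 (ltW st) tl.
  rewrite -ind_v -!integZ; [|exact: (sqi_integr2 gi)|by apply: sqiM => //; exact: continuous_sqi].
  rewrite -integD//; last by apply: integrZ; exact: sqi_integr2.
  apply: le_integ.
  - by apply: integrZ; apply: sqiM => //; exact: continuous_sqi.
  - by apply: integrD => //; apply: integrZ; exact: sqi_integr2.
  move=> x _; have /andP[p0 p1] := plateau_itv d0 ds x.
  have pi := @plateau_le_indic s t d d0 ds x.
  rewrite -/phi in p0 p1 pi.
  have := sqr_ge0 (lam * g x - phi x); nra.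
have err : 2 * lam * (f t - f s) <= 2 * lam * integ l (fun x => g x * phi x) + e.
  rewrite -lerBlDl -mulrBr; apply: (le_trans (ler_norm _)); rewrite !normrM.
  have : `|f t - f s - integ l (fun x => g x * phi x)| <= 2 * e'.
    by move: bs bt; rewrite !ler_norml; move: by_parts; lra.
  move=> H; have -> : e = 2 * (`|lam| + 1) * (2 * e').
    by rewrite /e'; field; rewrite gt_eqF.
  by rewrite ger0_norm// ler_pM// ?mulr_ge0// ler_pM2l// lerDl.
lra.
Qed.

(** The integral of [g] over [[s, t]] is the limit of its integrals against
    plateaus, which vanish. *)
Lemma weak_zero_itv l g s t : square_integrable l g ->
  is_weak_derivative l (fun=> 0) g -> 0 <= s -> s < t -> t <= l ->
  integ l (fun x => g x * \1_(`]s, t[ : set R) x) = 0.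
Proof.
move=> gi g0 s0 st tl.
have [ind_i ind_v] := integ_indic s0 (ltW st) tl.
have ind_sqi : square_integrable l (\1_(`]s, t[ : set R)).
  split; first exact: measurable_indic.
  apply: eq_integrable ind_i => // x _ /=; congr EFin.
  by rewrite indicE; case: (_ \in _); rewrite ?expr1n ?expr0n.
set X := integ l _; have A0 : 0 <= integ l (fun x => g x ^+ 2).
  by apply: integ_ge0 => x _; exact: sqr_ge0.
suff : X ^+ 2 <= 0 * integ l (fun x => g x ^+ 2).
  by rewrite mul0r => X2; apply/eqP; rewrite -sqrf_eq0; apply/eqP/le_anti;
    rewrite X2 sqr_ge0.
apply: discriminant => // lam; rewrite addr0.
apply/ler_addgt0Pr => e e0.
pose d := Num.min ((t - s) / 3) (e / 2).
have d0 : 0 < d by rewrite !lt_min !divr_gt0// subr_gt0.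
have ds : 3 * d <= t - s by rewrite mulrC -ler_pdivlMr// ge_min lexx.
have de : 2 * d <= e by rewrite mulrC -ler_pdivlMr// ge_min lexx orbT.
pose phi := plateau s t d.
have tphi : test_function l phi := plateau_test s0 tl d0 ds.
have phi_sqi : square_integrable l phi.
  by apply: continuous_sqi => x _; exact: (test_function_continuous tphi).
have gphi : integ l (fun x => g x * phi x) = 0.
  have := g0 phi tphi; rewrite -[X in _ = - X]/(integ l (fun x => g x * phi x)).
  have -> : \int[mu]_(x in `]0, l[) (0 * derive1 phi x) = integ l (fun=> 0).
    by apply: eq_integ => x _; rewrite mul0r.
  by rewrite integ_cst ?mul0r; [move/eqP; rewrite eq_sym oppr_eq0 => /eqP|lra].
have [ind2_i ind2_v] : integr l (\1_(`]s + d, t - d[ : set R) : R -> R) /\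
    integ l \1_(`]s + d, t - d[ : set R) = (t - d) - (s + d).
  by apply: integ_indic; lra.
have g2 := integrZ (lam ^+ 2) (sqi_integr2 gi).
have gind := sqiM gi ind_sqi; have gph := sqiM gi phi_sqi.
have -> : 2 * lam * X = integ l (fun x => 2 * lam *
    (g x * \1_(`]s, t[ : set R) x - g x * phi x)).
  by rewrite integZ ?integB// ?gphi ?subr0//; exact: integrB.
apply: (@le_trans _ _ (integ l (fun x => lam ^+ 2 * g x ^+ 2 +
    (\1_(`]s, t[ : set R) x - \1_(`]s + d, t - d[ : set R) x)))); last first.
  rewrite integD// ?integB// ?integZ ?ind_v ?ind2_v; last exact: integrB.
    by lra.
  exact: sqi_integr2.
apply: le_integ.
- by apply: integrZ; exact: integrB.
- by apply: integrD => //; exact: integrB.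
move=> x _; have /andP[p0 p1] := plateau_itv d0 ds x.
have := @plateau_le_indic s t d d0 ds x; rewrite -/phi in p0 p1 *.
have ind01 : \1_(`]s, t[ : set R) x = 0 :> R \/ \1_(`]s, t[ : set R) x = 1 :> R.
  by rewrite indicE; case: (_ \in _); [right|left].
have := sqr_ge0 (lam * g x - (\1_(`]s, t[ : set R) x - phi x)).
have [x2|x2] := boolP (x \in `]s + d, t - d[%classic).
  have -> : phi x = 1.
    apply: plateau_on => //; move: x2; rewrite inE /= in_itv /= => /andP[*].
    by rewrite !ltW.
  have -> : \1_(`]s + d, t - d[ : set R) x = 1 :> R by rewrite indicE x2.
  by case: ind01 => ->; lra.
have -> : \1_(`]s + d, t - d[ : set R) x = 0 :> R by rewrite indicE (negPf x2).
by case: ind01 => ->; nra.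
Qed.

(** Lebesgue's differentiation theorem, applied to the primitive of [g], which
    vanishes. *)
Lemma weak_zero l g : 0 < l -> square_integrable l g ->
  is_weak_derivative l (fun=> 0) g -> {ae mu, forall x, `]0, l[%classic x -> g x = 0}.
Proof.
move=> l0 gi g0.
pose f : R -> R := g \_ `]0, l[.
have fi : mu.-integrable setT (EFin \o f).
  rewrite -restrict_EFin; apply/integrable_restrict => //=; rewrite setTI.
  exact: sqi_integr.
have lf : locally_integrable setT f.
  by apply: integrable_locally => //; exact: sqi_integr.
have F0 x : \int[mu]_(t in `]-oo, x]) f t = 0.
  have zero m : 0 < m <= l -> \int[mu]_(t in `]0, m[) g t = 0.
    move=> /andP[m0 ml].
    transitivity (integ l (fun x => g x * \1_(`]0, m[ : set R) x)); last first.
      exact: weak_zero_itv.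
    rewrite [in LHS](_ : [set` `]0, m[] = `]0, l[ `&` `]0, m[); last first.
      by rewrite setIidr//; exact: subset_itvl.
    rewrite Rintegral_mkcondr; apply: eq_Rintegral => t _.
    by rewrite patchE indicE; case: (_ \in _); rewrite ?mulr1 ?mulr0.
  rewrite /f -Rintegral_mkcondl.
  have [x0|x0] := leP x 0.
    rewrite (_ : _ `&` _ = set0) ?Rintegral_set0//.
    apply/seteqP; split=> // t [] /=; rewrite !in_itv /= => /andP[t0 _] tx.
    by move: (lt_le_trans t0 tx); rewrite ltNge x0.
  have [lx|xl] := leP l x.
    rewrite (_ : _ `&` _ = `]0, l[%classic) ?zero ?l0 ?lexx//.
    apply/setIidl => t /=; rewrite !in_itv /= => /andP[_ tl].
    by rewrite ltW// (lt_le_trans tl).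
  rewrite (_ : _ `&` _ = `]0, x]%classic).
    rewrite -Rintegral_itv_bndo_bndc ?zero ?x0 ?ltW//.
    apply: integrableS (sqi_integr gi) => //; exact/subset_itvl/ltW.
  apply/seteqP; split=> t /=; rewrite !in_itv /=.
    by move=> [/andP[-> _] ->].
  by move=> /andP[t0 tx]; rewrite t0 tx (le_lt_trans tx).
have fNy y : mu.-integrable `]-oo, y] (EFin \o f).
  by apply: integrableS fi => //; exact: measurable_itv.
have FTC := FTC1Ny fNy lf.
move: FTC; apply: filterS; first exact: (ae_filter_ringOfSetsType mu).
move=> x /= [_]; rewrite /derive1.
have -> : (fun h => h^-1 *: (\int[mu]_(t in `]-oo, h + x]) f t -
    \int[mu]_(t in `]-oo, x]) f t)) = fun=> 0 :> R.
  by apply/funext => h; rewrite !F0 subrr scaler0.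
rewrite lim_cst//.
by move=> + xl; rewrite /f patchE mem_set => //.
Qed.

Lemma weak_derivative_unique l f g g' : 0 < l -> square_integrable l f ->
  square_integrable l g -> square_integrable l g' ->
  is_weak_derivative l f g -> is_weak_derivative l f g' ->
  integ l (fun x => g x ^+ 2) = integ l (fun x => g' x ^+ 2).
Proof.
move=> l0 fi gi gi' fg fg'.
have dgi := sqi_lin 1 (-1) gi gi'.
have wz : is_weak_derivative l (fun=> 0) (fun x => 1 * g x + -1 * g' x).
  have := weak_derivative_lin 1 (-1) fi fi gi gi' fg fg'.
  by rewrite (_ : (fun x => 1 * f x + _) = fun=> 0)//; apply/funext => x; ring.
have := weak_zero l0 dgi wz => ae0.
rewrite /integ /Rintegral; congr fine; apply: ae_eq_integral => //.
- by have /sqi_integr2/measurable_int := gi.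
- by have /sqi_integr2/measurable_int := gi'.
move: ae0; apply: filterS; first exact: (ae_filter_ringOfSetsType mu).
move=> x /= H xl; congr EFin.
by have -> : g x = g' x by have := H xl; lra.
Qed.

End Interval.

(** * The Dirichlet integral *)

Section GraphGradient.
Context {R : realType} (G : metric_graph R).
Implicit Types (u v : gpoint G -> R) (e : edge G) (x y : gpoint G) (t : R)
  (g : edge G -> R -> R).

Definition is_grad u g : Prop := forall e,
  square_integrable (len e) (g e) /\ is_weak_derivative (len e) (restr u e) (g e).

Lemma restr_continuous u e : continuous u -> continuous (restr u e).
Proof.
by move=> cu t; apply: continuous_comp; [exact: chart_continuous|exact: cu].
Qed.

Lemma restr_sqi u e : continuous u -> square_integrable (len e) (restr u e).
Proof. by move=> cu; apply: continuous_sqi => t _; exact: restr_continuous. Qed.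

Lemma is_grad_ex u : H1 u -> exists g, is_grad u g.
Proof.
move=> [cu hu].
have ex e : exists g : R -> R, square_integrable (len e) g /\
    is_weak_derivative (len e) (restr u e) g.
  by have [_ [g gi gw]] := hu e; exists g.
by have [g gP] := choice ex; exists g => e; exact: gP.
Qed.

Lemma is_grad_H1 u g : continuous u -> is_grad u g -> H1 u.
Proof.
move=> cu gu; split=> // e; split; first exact: restr_sqi.
by have [gi gw] := gu e; exists (g e).
Qed.

Lemma dirichletE u g : continuous u -> is_grad u g ->
  dirichlet u = \sum_e integ (len e) (fun t => g e t ^+ 2).
Proof.
move=> cu gu; apply: eq_bigr => e _; have [gi gw] := gu e.
have [hi hw] : square_integrable (len e) (grad u e) /\
    is_weak_derivative (len e) (restr u e) (grad u e).
  by rewrite /grad /weak_derivative; case: xgetP => [h _ //|/(_ (g e))]; case.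
rewrite -(weak_derivative_unique (len_gt0 e) (restr_sqi e cu) hi gi hw gw).
by apply: eq_integ => t _; rewrite real_normK ?num_real.
Qed.

Lemma dirichlet_ge0 u : 0 <= dirichlet u.
Proof. by apply: sumr_ge0 => e _; apply: integ_ge0 => t _; exact: exprn_ge0. Qed.

Lemma continuous_lin (a b : R) u v : continuous u -> continuous v ->
  continuous (fun x => a * u x + b * v x).
Proof.
move=> cu cv; apply: graph_continuous => e t /=.
apply: (@cvgD R R^o).
  by apply: cvgM; [exact: cvg_cst|exact: (@restr_continuous u e cu t)].
by apply: cvgM; [exact: cvg_cst|exact: (@restr_continuous v e cv t)].
Qed.

Arguments continuous_lin a b {u v} _ _.

Lemma is_grad_lin (a b : R) u v g h : continuous u -> continuous v ->
  is_grad u g -> is_grad v h ->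
  is_grad (fun x => a * u x + b * v x) (fun e t => a * g e t + b * h e t).
Proof.
move=> cu cv gu hv e; have [gi gw] := gu e; have [hi hw] := hv e.
split; first exact: sqi_lin.
exact: (weak_derivative_lin a b (restr_sqi e cu) (restr_sqi e cv) gi hi gw hw).
Qed.

Arguments is_grad_lin a b {u v g h} _ _ _ _.

Lemma is_grad_C1 u g : continuous u ->
  (forall e, {in `[0, len e], continuous (g e)}) ->
  (forall e t, 0 < t < len e -> is_derive t 1 (restr u e) (g e t)) -> is_grad u g.
Proof.
move=> cu cg dg e; split; first exact: continuous_sqi.
apply: weak_derivative_C1 => //; first exact: len_gt0.
  by move=> t _; exact: restr_continuous.
Qed.

Lemma is_grad_cst (c : R) : is_grad (fun=> c) (fun _ _ => 0).
Proof.
apply: is_grad_C1 => [|e t _|e t _]; [exact: cst_continuous|exact: cvg_cst|].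
exact: is_derive_cst.
Qed.

Lemma H1_lin (a b : R) u v : H1 u -> H1 v -> H1 (fun x => a * u x + b * v x).
Proof.
move=> hu hv; have [g gu] := is_grad_ex hu; have [h gv] := is_grad_ex hv.
have [cu _] := hu; have [cv _] := hv.
exact: (is_grad_H1 (continuous_lin a b cu cv) (is_grad_lin a b cu cv gu gv)).
Qed.

Lemma H1_cst (c : R) : H1 (fun _ : gpoint G => c).
Proof. exact: (is_grad_H1 (@cst_continuous _ _ _) (is_grad_cst c)). Qed.

(** The Dirichlet integral is a quadratic form. *)
Lemma parallelogram u v : H1 u -> H1 v ->
  dirichlet (fun x => u x - v x) =
  2 * dirichlet u + 2 * dirichlet v - 4 * dirichlet (fun x => (u x + v x) / 2).
Proof.
move=> hu hv; have [g gu] := is_grad_ex hu; have [h gv] := is_grad_ex hv.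
have [cu _] := hu; have [cv _] := hv.
have -> : (fun x => u x - v x) = (fun x => 1 * u x + -1 * v x).
  by apply/funext => x; ring.
have -> : (fun x => (u x + v x) / 2) = (fun x => 2^-1 * u x + 2^-1 * v x).
  by apply/funext => x; ring.
rewrite (dirichletE (continuous_lin 1 (-1) cu cv) (is_grad_lin 1 (-1) cu cv gu gv)).
rewrite (dirichletE (continuous_lin 2^-1 2^-1 cu cv)
  (is_grad_lin 2^-1 2^-1 cu cv gu gv)).
rewrite (dirichletE cu gu) (dirichletE cv gv) !mulr_sumr -big_split /= -sumrB.
apply: eq_bigr => e _; have [gi _] := gu e; have [hi _] := gv e.
have i1 := integrZ 2 (sqi_integr2 gi); have i2 := integrZ 2 (sqi_integr2 hi).
have i3 := integrZ 4 (sqi_integr2 (sqi_lin 2^-1 2^-1 gi hi)).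
have i4 := sqi_integr2 (sqi_lin 2^-1 2^-1 gi hi).
rewrite -!integZ//; try exact: sqi_integr2.
rewrite -integD// -integB//; last exact: integrD.
by apply: eq_integ => t _; field.
Qed.

Lemma dirichletZ (a : R) u : H1 u -> dirichlet (fun x => a * u x) = a ^+ 2 * dirichlet u.
Proof.
move=> hu; have [g gu] := is_grad_ex hu; have [cu _] := hu.
have -> : (fun x => a * u x) = (fun x => a * u x + 0 * u x).
  by apply/funext => x; ring.
rewrite (dirichletE (continuous_lin a 0 cu cu) (is_grad_lin a 0 cu cu gu gu)).
rewrite (dirichletE cu gu) mulr_sumr; apply: eq_bigr => e _; have [gi _] := gu e.
rewrite -integZ; last exact: sqi_integr2.
by apply: eq_integ => t _; ring.
Qed.

Lemma H1Z (a : R) u : H1 u -> H1 (fun x => a * u x).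
Proof.
move=> hu; have -> : (fun x => a * u x) = (fun x => a * u x + 0 * u x).
  by apply/funext => x; ring.
exact: H1_lin.
Qed.

Lemma H1_addc (c : R) u : H1 u ->
  H1 (fun x => u x + c) /\ dirichlet (fun x => u x + c) = dirichlet u.
Proof.
move=> hu; have [g gu] := is_grad_ex hu; have [cu _] := hu.
have -> : (fun x => u x + c) = (fun x => 1 * u x + 1 * c).
  by apply/funext => x; ring.
have cc : continuous (fun _ : gpoint G => c) by exact: cst_continuous.
split; first exact: (H1_lin 1 1 hu (H1_cst c)).
rewrite (dirichletE (continuous_lin 1 1 cu cc) (is_grad_lin 1 1 cu cc gu (is_grad_cst c))).
rewrite (dirichletE cu gu); apply: eq_bigr => e _.
by apply: eq_integ => t _; ring.
Qed.

Context (acyclicG : without_cycles G).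

(** The inequalities of [weak_increment] are added up over the edges along
    which [x] and [y] differ; the optimal parameter gives Cauchy-Schwarz. *)
Lemma increment_le u x y : H1 u ->
  (u y - u x) ^+ 2 <= tdist x y * dirichlet u.
Proof.
move=> hu; have [g gu] := is_grad_ex hu; have [cu _] := hu.
apply: discriminant => [||lam]; [exact: dirichlet_ge0|exact: tdist_ge0|].
rewrite (dirichletE cu gu) (increment_decomposition acyclicG u).
rewrite !mulr_sumr -big_split /=; apply: ler_sum => e _.
have [gi gw] := gu e; have ce : {in `[0, len e], continuous (restr u e)}.
  by move=> t _; exact: restr_continuous.
have /andP[x0 xl] := coord_itv acyclicG e x.
have /andP[y0 yl] := coord_itv acyclicG e y.
have [xy|yx] := leP (coord e x) (coord e y).
  have := weak_increment lam gi gw ce x0 xy yl.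
  by rewrite ler0_norm ?subr_le0// opprB.
have := weak_increment (- lam) gi gw ce y0 (ltW yx) xl.
rewrite gtr0_norm ?subr_gt0// sqrrN /restr; lra.
Qed.

End GraphGradient.

(** * Solutions of the Lane-Emden problem *)

Section Powers.
Context {R : realType}.
Implicit Types (p y : R).

(** The nonlinearity of the Lane-Emden equation. *)
Definition psi p y : R := `|y| `^ (p - 1) * y.

Lemma normr_psi p y : 0 < p -> `|psi p y| = `|y| `^ p.
Proof.
move=> p0; rewrite /psi normrM ger0_norm ?powR_ge0// mulrC.
by rewrite mulr_powRB1// normr_ge0.
Qed.

Lemma psi_mul p y : 0 < p -> psi p y * y = `|y| `^ (p + 1).
Proof.
move=> p0; rewrite powRD; last first.
  by apply/implyP => /eqP H; exfalso; lra.
by rewrite powRr1 ?normr_ge0// -(normr_psi y p0) -normrM ger0_norm// /psi -mulrA;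
  rewrite mulr_ge0 ?powR_ge0 -?expr2 ?sqr_ge0.
Qed.

Lemma psi_continuous p : 1 < p -> continuous (psi p).
Proof.
move=> p1 y; have [->|y0] := eqVneq y 0.
  apply/cvgrPdist_le => e e0; near=> x.
  rewrite /psi mulr0 sub0r normrN -/(psi p x) normr_psi ?(lt_trans ltr01)//.
  have xe : `|x| <= Num.min 1 e.
    near: x; apply/nbhs_ballP; exists (Num.min 1 e); first by rewrite /= lt_min ltr01.
    by move=> z; rewrite /ball /= sub0r normrN; exact: ltW.
  move: xe; rewrite le_min => /andP[x1 xe].
  have [->|x0] := eqVneq x 0.
    by rewrite normr0 powR0 ?(ltW e0)// gt_eqF// (lt_trans ltr01).
  by apply: le_trans xe; apply: ge1r_powR; rewrite ?normr_gt0 ?x0 ?x1// ltW.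
apply: cvgM; last exact: cvg_id.
apply: (@continuous_comp R R R (fun x => `|x|) (fun a => a `^ (p - 1))).
  exact: norm_continuous.
apply: differentiable_continuous; apply/derivable1_diffP.
by apply: derivable_powR; rewrite in_itv /= andbT normr_gt0.
Unshelve. all: by end_near. Qed.

End Powers.

Section EdgeEquation.
Context {R : realType}.
Local Notation mu := (@lebesgue_measure R).
Implicit Types (f q F : R -> R) (l t x : R).

Lemma continuous_primitive q : continuous q ->
  exists Q : R -> R, forall t, -1 < t -> is_derive t 1 Q (q t).
Proof.
move=> cq; exists (fun t => \int[mu]_(s in `[-1, t]) q s) => t t1.
have [||dQ Q'] := @continuous_FTC1_closed R q (-1) t (t + 1) _ _ t1 (cq t).
- by rewrite ltrDl.
- apply: continuous_compact_integrable; first exact: segment_compact.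
  exact: continuous_subspaceT.
by rewrite -Q' derive1E; exact: DeriveDef.
Qed.

Lemma derivable_within_continuous f (a b : R) :
  (forall x, a <= x <= b -> derivable f x 1) -> {within `[a, b], continuous f}.
Proof.
move=> df; apply: continuous_in_subspaceT => x; rewrite inE /= in_itv => /df d.
by apply: differentiable_continuous; exact/derivable1_diffP.
Qed.

Lemma derive0_constant F (a b : R) : (forall x, a < x < b -> is_derive x 1 F 0) ->
  forall x y, a < x < b -> a < y < b -> F x = F y.
Proof.
move=> dF; have lt x y : a < x < b -> a < y < b -> x < y -> F x = F y.
  move=> /andP[ax xb] /andP[ay yb] xy.
  have [||c _] := @MVT R F (fun=> 0) x y xy.
  - move=> z; rewrite in_itv => /andP[xz zy]; apply: dF.
    by rewrite (lt_trans ax)// (lt_trans zy).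
  - apply: derivable_within_continuous => z /andP[xz zy].
    have zab : a < z < b by rewrite (lt_le_trans ax)//= (le_lt_trans zy).
    by have [] := dF z zab.
  by rewrite mul0r => /eqP; rewrite subr_eq0 => /eqP ->.
move=> x y xab yab; have [xy|yx|->//] := ltgtP x y; first exact: lt.
by rewrite (lt y x).
Qed.

(** The derivative of a solution of [- f'' = q] extends continuously to the
    ends, because it differs from a primitive of [q] by a constant. *)
Lemma edge_solution f q l : 0 < l -> continuous f -> continuous q ->
  (forall x, x \in `]0, l[ -> [/\ derivable f x 1, derivable (derive1 f) x 1
     & - derive1 (derive1 f) x = q x]) ->
  exists V : R -> R, [/\ {in `[0, l], continuous V},
    forall x, 0 < x < l -> is_derive x 1 f (V x),
    forall x, 0 < x < l -> is_derive x 1 V (- q x),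
    (f h - f 0) / h @[h --> 0^'+] --> V 0
  & (f (l - h) - f l) / h @[h --> 0^'+] --> - V l].
Proof.
move=> l0 cf cq eqf; have [Q dQ] := continuous_primitive cq.
pose C : R := derive1 f (l / 2) + Q (l / 2); pose V x : R := C - Q x.
have df x : 0 < x < l -> is_derive x 1 f (V x).
  move=> xl; have [d1 d2 e2] := eqf x xl.
  have dfx : is_derive x 1 f (derive1 f x) by rewrite derive1E; exact: DeriveDef.
  suff Vx : V x = derive1 f x by move: dfx; rewrite -Vx.
  rewrite /V /C; suff -> : derive1 f (l / 2) + Q (l / 2) = derive1 f x + Q x by ring.
  apply: (@derive0_constant (fun x => derive1 f x + Q x) 0 l) => [y yl| |]; last exact: xl.
    have [_ dy ey] := eqf y yl.
    have dQy : is_derive y 1 Q (q y).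
      by apply: dQ; case/andP: yl => y0 _; apply: lt_trans y0; exact: ltrN10.
    have df'y : is_derive y 1 (derive1 f) (- q y).
      by rewrite -ey opprK derive1E; exact: DeriveDef.
    by apply: is_derive_eq; rewrite addNr.
  by apply/andP; split; lra.
have cV x : -1 < x -> {for x, continuous V}.
  move=> x1; have [dQx _] := dQ x x1.
  apply: cvgB; first exact: cvg_cst.
  by apply: differentiable_continuous; exact/derivable1_diffP.
have cfw a b : {within `[a, b], continuous f} by exact: continuous_subspaceT.
exists V; split.
- by move=> x; rewrite in_itv /= => /andP[x0 _]; apply: cV; exact: lt_le_trans x0.
- exact: df.
- move=> x xl; have dQx : is_derive x 1 Q (q x).
    by apply: dQ; case/andP: xl => x0 _; apply: lt_trans x0; exact: ltrN10.
  rewrite (_ : V = cst C - Q)//; have := is_deriveB (is_derive_cst C x 1) dQx.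
  by rewrite sub0r.
- apply/cvgrPdist_le => e e0.
  have /cvgrPdist_le/(_ e e0)/nbhs_ballP[d d0 Vd] := cV 0 ltac:(lra).
  near=> h.
  have h0 : 0 < h by [].
  have hl : h < l by near: h; exact: nbhs_right_lt.
  have hd : h < d by near: h; exact: nbhs_right_lt.
  have [|c] := @MVT R f V 0 h h0 _ (cfw _ _).
    by move=> z; rewrite in_itv /= => /andP[z0 zh]; apply: df; rewrite z0 (lt_trans zh).
  rewrite in_itv /= subr0 => /andP[c0 ch] ->.
  rewrite mulfK ?gt_eqF//; apply: Vd.
  by rewrite /ball /= sub0r normrN gtr0_norm// (lt_trans ch).
- apply/cvgrPdist_le => e e0.
  have /cvgrPdist_le/(_ e e0)/nbhs_ballP[d d0 Vd] := cV l ltac:(lra).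
  near=> h.
  have h0 : 0 < h by [].
  have hl : h < l by near: h; exact: nbhs_right_lt.
  have hd : h < d by near: h; exact: nbhs_right_lt.
  have lh : l - h < l by lra.
  have [|c] := @MVT R f V (l - h) l lh _ (cfw _ _).
    move=> z; rewrite in_itv /= => /andP[z0 zh]; apply: df.
    by rewrite zh andbT (lt_trans _ z0)// subr_gt0.
  have -> : l - (l - h) = h by rewrite opprB addrC subrK.
  rewrite in_itv /= => /andP[c0 cl] fc.
  have -> : (f (l - h) - f l) / h = - V c.
    by rewrite -opprB fc mulNr mulfK ?gt_eqF.
  rewrite opprK addrC -normrN opprB; apply: Vd.
  by rewrite /ball /= gtr0_norm; lra.
Unshelve. all: by end_near. Qed.

End EdgeEquation.

Section Solutions.
Context {R : realType} (G : metric_graph R) (p : R) (u : gpoint G -> R).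
Implicit Types (e : edge G) (v : vertex G).
Context (p_gt1 : 1 < p) (sol_u : lane_emden_solution p u).

Lemma psi_restr_continuous (w : gpoint G -> R) e : continuous w ->
  continuous (fun t => psi p (restr w e t)).
Proof.
move=> cw t; apply: (@continuous_comp R R R (restr w e) (psi p)).
  exact: restr_continuous.
exact: psi_continuous.
Qed.

Lemma sum_incident e (F : vertex G -> R) :
  \sum_(v | incident e v) F v = F (src e) + F (tgt e).
Proof.
have st := loopless e.
rewrite (bigD1 (src e)) ?/incident ?eqxx//=; congr (_ + _).
rewrite (big_pred1 (tgt e))// => v /=.
have [->|sv] := eqVneq v (src e); first by rewrite andbF (negPf st).
by rewrite /= andbT eq_sym.
Qed.

Lemma kirchhoff v : \sum_(e | incident e v) outward_derivative u e v = 0.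
Proof.
have [_ _ _ k3 k1] := sol_u.
have /orP[/eqP d1|d3] := degree_1_or_ge3 v; last exact: k3.
by apply: big1 => e ev; exact: k1 ev.
Qed.

(** [V] is the derivative of [u] up to the ends of the edges. The last clause
    collects the boundary terms in an integration by parts against a function with
    values [F] at the vertices: regrouped by vertex, they cancel by Kirchhoff's
    rule. *)
Lemma solution_data : exists V : edge G -> R -> R, [/\ is_grad u V,
    forall e, {in `[0, len e], continuous (V e)},
    forall e t, 0 < t < len e -> is_derive t 1 (restr u e) (V e t),
    forall e t, 0 < t < len e -> is_derive t 1 (V e) (- psi p (restr u e t))
  & forall F : vertex G -> R,
    \sum_e (F (tgt e) * V e (len e) - F (src e) * V e 0) = 0].
Proof.
have [cu eq_u _ _ _] := sol_u.
have /choice[V VP] e := edge_solution (len_gt0 e) (@restr_continuous _ _ u e cu)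
  (psi_restr_continuous (e := e) cu) (eq_u e).
exists V; split.
- apply: is_grad_C1 => // e; first by have [] := VP e.
  by have [_ d _ _ _] := VP e; exact: d.
- by move=> e; have [] := VP e.
- by move=> e; have [] := VP e.
- by move=> e; have [] := VP e.
have od_src e : outward_derivative u e (src e) = V e 0.
  have [_ _ _ l0 _] := VP e; apply: cvg_lim => //.
  move: l0; rewrite /outward_quotient eqxx.
  by have -> : u (inl (src e)) = restr u e 0 by rewrite /restr chart0.
have od_tgt e : outward_derivative u e (tgt e) = - V e (len e).
  have [_ _ _ _ ll] := VP e; apply: cvg_lim => //.
  move: ll; rewrite /outward_quotient (negPf (loopless e)).
  by have -> : u (inl (tgt e)) = restr u e (len e) by rewrite /restr chart_len.
move=> F; have -> : \sum_e (F (tgt e) * V e (len e) - F (src e) * V e 0) =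
    - \sum_e \sum_(v | incident e v) F v * outward_derivative u e v.
  rewrite -sumrN; apply: eq_bigr => e _.
  by rewrite sum_incident od_src od_tgt; ring.
rewrite (exchange_big_dep xpredT)//= big1 ?oppr0// => v _.
by rewrite -mulr_sumr kirchhoff mulr0.
Qed.

Lemma solution_H1 : H1 u.
Proof.
have [cu _ _ _ _] := sol_u; have [V [gV _ _ _ _]] := solution_data.
exact: is_grad_H1 gV.
Qed.

(** The equation is tested with [u] itself. *)
Lemma solution_dirichlet : dirichlet u =
  \sum_e integ (len e) (fun t => `|restr u e t| `^ (p + 1)).
Proof.
have [cu _ _ _ _] := sol_u; have [V [gV cV du dV kV]] := solution_data.
rewrite (dirichletE cu gV); apply/eqP; rewrite -subr_eq0 -sumrB.
apply/eqP; apply: etrans (kV (fun v => u (inl v))); apply: eq_bigr => e _.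
have ce : {in `[0, len e], continuous (restr u e)}.
  by move=> t _; exact: restr_continuous.
have i1 : integr (len e) (fun t => V e t ^+ 2).
  by apply: sqi_integr2; exact: continuous_sqi.
have eqp : (fun t => `|restr u e t| `^ (p + 1)) =
    (fun t => psi p (restr u e t) * restr u e t).
  by apply/funext => t; rewrite psi_mul// (lt_trans ltr01).
have cq : {in `[0, len e], continuous (fun t => psi p (restr u e t) * restr u e t)}.
  by move=> t tl; apply: cvgM; [exact: psi_restr_continuous|exact: ce].
rewrite eqp -integB//; last exact: continuous_integr.
have -> : u (inl (tgt e)) = restr u e (len e) by rewrite /restr chart_len.
have -> : u (inl (src e)) = restr u e 0 by rewrite /restr chart0.
apply: (@integ_derive R 0 (len e) (fun t => restr u e t * V e t)); first exact: len_gt0.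
- by move=> t tl; apply: continuousM; [exact: ce|exact: cV].
- move=> t tl; apply: cvgB; last exact: cq.
  by apply: continuousM; exact: cV.
move=> t tl; have d1 := du e t tl; have d2 := dV e t tl.
by apply: is_derive_eq; rewrite /GRing.scale /=; ring.
Qed.

(** The equation is tested with the constant [1]. *)
Lemma solution_mean0 : \sum_e integ (len e) (fun t => psi p (restr u e t)) = 0.
Proof.
have [cu _ _ _ _] := sol_u; have [V [_ cV du dV kV]] := solution_data.
apply/eqP; rewrite -oppr_eq0 -sumrN; apply/eqP; apply: etrans (kV (fun=> 1)).
apply: eq_bigr => e _; rewrite !mul1r -mulN1r -integZ; last first.
  by apply: continuous_integr => t _; exact: psi_restr_continuous.
apply: integ_derive; [exact: len_gt0|exact: cV| |].
  by move=> t _; apply: cvgM; [exact: cvg_cst|exact: psi_restr_continuous].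
by move=> t tl; rewrite mulN1r; exact: dV.
Qed.

End Solutions.

(** * Bounds on the least energy *)

Section PowerGrowth.
Context {R : realType}.
Implicit Types (p y r : R).

Lemma psi_ge0 p y : 0 <= y -> 0 <= psi p y.
Proof. by move=> y0; rewrite mulr_ge0 ?powR_ge0. Qed.

Lemma psi_le0 p y : y <= 0 -> psi p y <= 0.
Proof. by move=> y0; rewrite mulr_ge0_le0 ?powR_ge0. Qed.

Lemma psiN p y : psi p (- y) = - psi p y.
Proof. by rewrite /psi normrN mulrN. Qed.

Lemma psi_pos p y : 0 < p -> 0 <= y -> psi p y = y `^ p.
Proof.
move=> p0 y0; rewrite -[LHS]ger0_norm ?psi_ge0// normr_psi//.
by rewrite ger0_norm.
Qed.

Lemma psi_homo p y z : 0 < p -> 0 <= y -> y <= z -> psi p y <= psi p z.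
Proof.
move=> p0 y0 yz; rewrite !psi_pos//; last exact: le_trans yz.
by apply: ge0_ler_powR; rewrite ?nnegrE ?(ltW p0)// (le_trans y0).
Qed.

(** For [y <= r] the values of [psi p y] that are positive are at most [r ^ p], so
    [|psi p y| <= 2 * r ^ p - psi p y]. The last term integrates to [0] for a
    solution. *)
Lemma power_le_psi p r (M : R) : 0 < p -> 0 <= r -> 0 <= M -> forall y, y <= r ->
  `|y| <= M -> `|y| `^ (p + 1) <= M * (2 * r `^ p) - M * psi p y.
Proof.
move=> p0 r0 M0 y yr yM; rewrite -psi_mul// -mulrBr.
have rp0 : 0 <= r `^ p by exact: powR_ge0.
have [y0|y0] := leP 0 y.
  have q0 := psi_ge0 p y0; have yM' : y <= M by rewrite ger0_norm in yM.
  have : psi p y <= psi p r by exact: psi_homo.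
  rewrite (psi_pos p0 r0) => qr.
  apply: (@le_trans _ _ (psi p y * M)); first by rewrite ler_wpM2l.
  by rewrite mulrC ler_wpM2l//; lra.
have q0 := psi_le0 p (ltW y0); have yM' : - y <= M by rewrite ltr0_norm in yM.
have -> : psi p y * y = - psi p y * - y by rewrite mulrNN.
apply: (@le_trans _ _ (- psi p y * M)).
  by rewrite ler_wpM2l// oppr_ge0.
by rewrite mulrC ler_wpM2l//; lra.
Qed.

(** With [b = exp (2 * k)], the power is the square of [exp (k * (p - 1))], which
    exceeds [(k * (p - 1)) ^ 2]. *)
Lemma powR_growth (b C : R) : 1 < b -> 0 < C ->
  exists2 P : R, 1 < P & forall p, P <= p -> p + 1 <= C * b `^ (p - 1).
Proof.
move=> b1 C0; pose k := ln b / 2.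
have b0 : 0 < b by rewrite (lt_trans ltr01).
have k0 : 0 < k by rewrite divr_gt0// ln_gt0.
have k2C : 0 < k ^+ 2 * C by rewrite mulr_gt0// exprn_gt0.
exists (3 + 4 / (k ^+ 2 * C)) => [|p pP].
  by rewrite ltr_wpDr ?divr_ge0 ?ltW// ltr1n.
have q0 : 0 < 4 / (k ^+ 2 * C) by rewrite divr_gt0.
have pk : 4 <= k ^+ 2 * C * (p - 1).
  by rewrite mulrC -ler_pdivrMr//; lra.
have -> : b `^ (p - 1) = expR (k * (p - 1)) ^+ 2.
  by rewrite /powR gt_eqF// -expRM_natl /k; congr expR; field.
have ge : k * (p - 1) <= expR (k * (p - 1)).
  by have := expR_ge1Dx (k * (p - 1)); lra.
have kp0 : 0 <= k * (p - 1) by apply: mulr_ge0; lra.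
have : (k * (p - 1)) ^+ 2 <= expR (k * (p - 1)) ^+ 2.
  by rewrite lerXn2r// nnegrE// expR_ge0.
rewrite -(ler_pM2l C0); apply: le_trans.
have -> : C * (k * (p - 1)) ^+ 2 = k ^+ 2 * C * (p - 1) * (p - 1) by ring.
apply: (@le_trans _ _ (4 * (p - 1))); first lra.
by rewrite ler_wpM2r//; lra.
Qed.

Lemma powR_decay r (e : R) : 0 < r -> r < 1 -> 0 < e ->
  exists2 P : R, 1 < P & forall p, P <= p -> r `^ p <= e.
Proof.
move=> r0 r1 e0; have [||P P1 HP] := @powR_growth r^-1 e; [|by []|].
  by rewrite invf_gt1.
exists P => // p /[dup] pP /HP; have p0 : 0 < p by lra.
have rr : r `^ (p - 1) * r^-1 `^ (p - 1) = 1.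
  by rewrite -powRM ?ltW ?invr_gt0// mulfV ?gt_eqF// powR1.
rewrite -(mulr_powRB1 (ltW r0) p0) => H.
have s0 : 0 <= r `^ (p - 1) by exact: powR_ge0.
have : r `^ (p - 1) * (p + 1) <= e.
  apply: (le_trans (ler_wpM2l s0 H)).
  by rewrite mulrCA rr mulr1.
nra.
Qed.

(** The energy on the ray through a function with Dirichlet integral [4 / d],
    whose modulus is at least [1 - eta] on a set of measure [dl]: up to
    [t * (1 - eta) = 1 + eta] the quadratic term is small enough, and beyond
    that the power term exceeds it. *)
Lemma ray_bound (d eta dl t p N : R) : 0 < d -> 0 < eta -> eta < 1 -> 0 < dl ->
  0 < t -> 1 < p ->
  p + 1 <= dl * d * (1 - eta) ^+ 2 / 2 * (1 + eta) `^ (p - 1) ->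
  dl * (t * (1 - eta)) `^ (p + 1) <= N ->
  t ^+ 2 * (4 / d) / 2 - (p + 1)^-1 * N <= 2 / d * ((1 + eta) / (1 - eta)) ^+ 2.
Proof.
move=> d0 eta0 eta1 dl0 t0 p1; have r0 : 0 < 1 - eta by rewrite subr_gt0.
set r := 1 - eta in r0 *; move=> Hp Nlow.
have tr0 : 0 < t * r by rewrite mulr_gt0.
have p10 : 0 < p + 1 by rewrite ltr_pwDr// ltW// (lt_trans ltr01).
have N0 : 0 <= (p + 1)^-1 * N.
  rewrite mulr_ge0 ?invr_ge0 ?(ltW p10)//; apply: le_trans Nlow.
  by rewrite mulr_ge0 ?powR_ge0// ltW.
have d20 : 0 < 2 / d by rewrite divr_gt0.
have [small|large] := leP (t * r) (1 + eta).
  apply: (@le_trans _ _ (t ^+ 2 * (4 / d) / 2)); first by rewrite gerBl.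
  have -> : t ^+ 2 * (4 / d) / 2 = 2 / d * ((t * r) / r) ^+ 2.
    by rewrite mulfK ?gt_eqF//; field; rewrite gt_eqF.
  rewrite ler_pM2l// lerXn2r ?nnegrE ?divr_ge0 ?(ltW r0) ?(ltW tr0) ?addr_ge0
    ?ler01 ?(ltW eta0)//.
  by rewrite ler_pM2r// invr_gt0.
apply: (@le_trans _ _ 0); last by rewrite mulr_ge0 ?sqr_ge0// ltW.
have powE : (t * r) `^ (p + 1) = (t * r) ^+ 2 * (t * r) `^ (p - 1).
  rewrite -powR_mulrn ?(ltW tr0)// -powRD; last by rewrite (gt_eqF tr0) implybT.
  by congr powR; ring.
have b_le : (1 + eta) `^ (p - 1) <= (t * r) `^ (p - 1).
  by apply: ge0_ler_powR; rewrite ?nnegrE ?(ltW large) ?(ltW tr0)//; lra.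
have C0 : 0 <= dl * d * r ^+ 2 / 2 by rewrite divr_ge0// !mulr_ge0 ?exprn_ge0 // ltW.
have Hp' := le_trans Hp (ler_wpM2l C0 b_le).
rewrite subr_le0 ler_pdivlMl//; apply: le_trans Nlow; rewrite powE.
have t2 : 0 < t ^+ 2 * (2 / d) by rewrite mulr_gt0 ?exprn_gt0.
have -> : (p + 1) * (t ^+ 2 * (4 / d) / 2) = t ^+ 2 * (2 / d) * (p + 1).
  by field; rewrite gt_eqF.
have -> : dl * ((t * r) ^+ 2 * (t * r) `^ (p - 1)) =
    t ^+ 2 * (2 / d) * (dl * d * r ^+ 2 / 2 * (t * r) `^ (p - 1)).
  by field; rewrite gt_eqF.
by rewrite ler_pM2l.
Qed.

End PowerGrowth.

Section Energy.
Context {R : realType} (G : metric_graph R).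
Implicit Types (u v : gpoint G -> R) (e : edge G) (x y : gpoint G) (p : R).

Definition power_integral p u : R := \sum_e integ (len e) (fun t => `|restr u e t| `^ (p + 1)).
Definition psi_integral p u : R := \sum_e integ (len e) (fun t => psi p (restr u e t)).

Lemma energyE p u : energy p u = dirichlet u / 2 - (p + 1)^-1 * power_integral p u.
Proof. by []. Qed.

Lemma power_integral_integr p u e : 1 < p -> continuous u ->
  integr (len e) (fun t => `|restr u e t| `^ (p + 1)).
Proof.
move=> p1 cu; have -> : (fun t => `|restr u e t| `^ (p + 1)) =
    (fun t => psi p (restr u e t) * restr u e t).
  by apply/funext => t; rewrite psi_mul// (lt_trans ltr01).
apply: continuous_integr => t _.
by apply: cvgM; [exact: psi_restr_continuous|exact: restr_continuous].
Qed.

Lemma psi_integr p u e : 1 < p -> continuous u ->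
  integr (len e) (fun t => psi p (restr u e t)).
Proof. by move=> p1 cu; apply: continuous_integr => t _; exact: psi_restr_continuous. Qed.

Lemma power_integral_le_total p u : 1 < p -> continuous u -> (forall x, `|u x| <= 1) ->
  power_integral p u <= total_length G.
Proof.
move=> p1 cu u1; apply: ler_sum => e _; rewrite -[leRHS]mul1r -integ_cst ?len_gt0//.
apply: le_integ => [||t _]; first exact: power_integral_integr.
  by apply: continuous_integr => t _; exact: cvg_cst.
have p10 : 0 <= p + 1 by lra.
apply: (@le_trans _ _ (1 `^ (p + 1))); last by rewrite powR1.
by apply: ge0_ler_powR; rewrite ?nnegrE ?ler01//; exact: u1.
Qed.

Lemma power_integral_lower p u e (s t r : R) : 1 < p -> continuous u -> 0 <= r ->
  0 <= s -> s <= t -> t <= len e ->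
  (forall z, s < z < t -> r <= `|restr u e z|) -> (t - s) * r `^ (p + 1) <= power_integral p u.
Proof.
move=> p1 cu r0 s0 st tl ru; rewrite /power_integral (bigD1 e)//=.
apply: ler_wpDr.
  by apply: sumr_ge0 => g _; apply: integ_ge0 => z _; exact: powR_ge0.
have [ind_i <-] := integ_indic s0 st tl.
rewrite mulrC -integZ//; apply: le_integ; [exact: integrZ|exact: power_integral_integr|].
move=> z _; rewrite indicE; have [|] := boolP (z \in _); last by rewrite mulr0 powR_ge0.
rewrite inE /= in_itv /= mulr1 => /ru rz; apply: ge0_ler_powR; rewrite ?nnegrE//; lra.
Qed.

Lemma psi_integralN p u : 1 < p -> continuous u ->
  psi_integral p (fun x => - u x) = - psi_integral p u.
Proof.
move=> p1 cu; rewrite /psi_integral -sumrN; apply: eq_bigr => e _.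
rewrite -mulN1r -integZ; last exact: psi_integr.
by apply: eq_integ => t _; rewrite mulN1r -psiN.
Qed.

Lemma psi_integral_gt0 p u (c : R) : 1 < p -> continuous u -> 0 < c ->
  (forall x, c <= u x) -> 0 < psi_integral p u.
Proof.
move=> p1 cu c0 uc; have p0 : 0 < p by lra.
have pc : 0 < psi p c by rewrite psi_pos ?powR_gt0// ltW.
have [e0 _] := edge_exists G.
rewrite /psi_integral (bigD1 e0)//=.
have low e : psi p c * len e <= integ (len e) (fun t => psi p (restr u e t)).
  rewrite -integ_cst ?len_gt0//; apply: le_integ; last 1 first.
  - by move=> t _; apply: psi_homo; rewrite ?(ltW c0)//; exact: uc.
  - by apply: continuous_integr => t _; exact: cvg_cst.
  - exact: psi_integr.
apply: ltr_wpDr.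
  apply: sumr_ge0 => e _; apply: le_trans (low e).
  by rewrite mulr_ge0// ltW// len_gt0.
by apply: lt_le_trans (low e0); rewrite mulr_gt0// len_gt0.
Qed.

Context (acyclicG : without_cycles G).

Lemma total_length_gt0 : 0 < total_length G.
Proof.
have [v [w vw]] := diametral_vertices G.
by apply: (lt_le_trans (vertex_diameter_gt0 acyclicG)); rewrite -vw tdist_le_total.
Qed.

(** A function whose mean of [psi p] is [0] takes values of both signs, so it
    is bounded by its oscillation. *)
Lemma sup_bound p u x : 1 < p -> H1 u -> psi_integral p u = 0 ->
  u x ^+ 2 <= total_length G * dirichlet u.
Proof.
move=> p1 hu u0; have [cu _] := hu; have L0 := total_length_gt0.
have D0 := dirichlet_ge0 u.
rewrite leNgt; apply/negP; set M2 := _ * _ => lt.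
have osc y : (u y - u x) ^+ 2 <= M2.
  apply: (le_trans (increment_le acyclicG x y hu)).
  by rewrite ler_wpM2r// tdist_le_total.
have M0 : 0 <= M2 by rewrite mulr_ge0// ltW.
pose M := Num.sqrt M2; have MM : M ^+ 2 = M2 by rewrite sqr_sqrtr.
have Mge0 : 0 <= M by exact: sqrtr_ge0.
have oscM y : `|u y - u x| <= M.
  by rewrite -(ler_pXn2r (n := 2))// ?nnegrE// real_normK ?num_real// MM.
have xM : M < `|u x|.
  by rewrite -(ltr_pXn2r (n := 2))// ?nnegrE// real_normK ?num_real// MM.
have [ux|ux] := leP 0 (u x).
  rewrite ger0_norm// in xM.
  have := @psi_integral_gt0 p u (u x - M) p1 cu.
  rewrite u0 ltxx subr_gt0 => /(_ xM) H; apply: notF; apply: H => y.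
  by have := oscM y; rewrite ler_norml => /andP[*]; lra.
rewrite ltr0_norm// in xM.
have cNu : continuous (fun y => - u y).
  by have [] := H1Z (-1) hu; under eq_fun do rewrite mulN1r.
have := @psi_integral_gt0 p (fun y => - u y) (- u x - M) p1 cNu.
rewrite psi_integralN// u0 oppr0 ltxx subr_gt0 => /(_ xM) H; apply: notF; apply: H => y.
by have := oscM y; rewrite ler_norml => /andP[*]; lra.
Qed.

Lemma least_energy_ge p (c : R) :
  (forall v, admissible p v -> exists2 t, 0 < t & c <= energy p (fun x => t * v x)) ->
  (c%:E <= least_energy G p)%E.
Proof.
move=> H; apply: le_ereal_inf_tmp => _ [v /H[t t0 ct] <-].
apply: ereal_sup_ge; exists (energy p (fun x => t * v x))%:E; last by rewrite lee_fin.
by exists t.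
Qed.

Lemma least_energy_le p v (c : R) : admissible p v ->
  (forall t, 0 < t -> energy p (fun x => t * v x) <= c) ->
  (least_energy G p <= c%:E)%E.
Proof.
move=> av H; apply: ereal_inf_le; exists (ereal_sup [set (energy p (fun x => t * v x))%:E |
  t in [set t : R | 0 < t]]); first by exists v.
by apply: ge_ereal_sup => _ [t t0 <-]; rewrite lee_fin H.
Qed.

(** The multiple of an admissible function bounded by [1] in [sup_bound] has
    Dirichlet integral [1 / L], and its power term is negligible. *)
Lemma least_energy_lower p : 1 < p -> 4 * total_length G ^+ 2 <= p + 1 ->
  ((4 * total_length G)^-1%:E <= least_energy G p)%E.
Proof.
move=> p1 pL; have L0 := total_length_gt0; set L := total_length G in pL L0 *.
apply: least_energy_ge => v [hv vn0 v0]; have [cv _] := hv.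
have bound x := sup_bound x p1 hv v0; rewrite -/L in bound.
have D0 : 0 < dirichlet v.
  rewrite lt_neqAle dirichlet_ge0 andbT eq_sym; apply/eqP => D0; apply: vn0.
  apply/funext => x; have := bound x; rewrite D0 mulr0 => ux.
  by apply/eqP; rewrite -sqrf_eq0; apply/eqP/le_anti; rewrite ux sqr_ge0.
have LD : 0 < L * dirichlet v by rewrite mulr_gt0.
pose t := (Num.sqrt (L * dirichlet v))^-1.
have t0 : 0 < t by rewrite invr_gt0 sqrtr_gt0.
have t2 : t ^+ 2 * (L * dirichlet v) = 1.
  by rewrite /t exprVn sqr_sqrtr ?(ltW LD)// mulVf// gt_eqF.
exists t => //; rewrite energyE dirichletZ//.
have Dt : t ^+ 2 * dirichlet v = L^-1.
  by apply: (@mulIf _ L); rewrite ?gt_eqF// mulVf ?gt_eqF// -t2; ring.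
have tv x : `|t * v x| <= 1.
  rewrite -(ler_pXn2r (n := 2))// ?nnegrE// real_normK ?num_real// expr1n -t2.
  by rewrite exprMn ler_wpM2l// sqr_ge0.
have ctv : continuous (fun x => t * v x) by have [] := H1Z t hv.
have N1 := power_integral_le_total p1 ctv tv; rewrite -/L in N1.
have p10 : 0 < p + 1 by lra.
have Np : (p + 1)^-1 * power_integral p (fun x => t * v x) <= (4 * L)^-1.
  apply: (@le_trans _ _ ((p + 1)^-1 * L)).
    by rewrite ler_wpM2l// invr_ge0 ltW.
  rewrite mulrC ler_pdivrMr// mulrC ler_pdivlMr ?mulr_gt0//.
  by rewrite mulrC -mulrA -expr2.
rewrite Dt; have -> : (4 * L)^-1 = L^-1 / 2 - (4 * L)^-1.
  by field; rewrite gt_eqF.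
by rewrite lerB.
Qed.

End Energy.

(** * The limit profile *)

Section Profile.
Context {R : realType} (G : metric_graph R) (acyclicG : without_cycles G).
Context (v w : vertex G) (vw : tdist (inl v) (inl w) = vertex_diameter G).
Implicit Types (e : edge G) (x y : gpoint G).
Local Notation d := (vertex_diameter G).

(** As [pos] is constant on the branches of the path from [v] to [w], so is the
    profile. *)
Definition profile x : R := -1 + 2 * pos v w x / d.

Let d_gt0 : 0 < d. Proof. exact: vertex_diameter_gt0. Qed.

Lemma profile_src : profile (inl v) = -1.
Proof. by rewrite /profile pos_src mulr0 mul0r addr0. Qed.

Lemma profile_tgt : profile (inl w) = 1.
Proof. by rewrite /profile pos_tgt vw mulfK ?gt_eqF//; ring. Qed.

Lemma profile_itv x : -1 <= profile x <= 1.
Proof.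
have := pos_itv acyclicG v w x; rewrite vw => /andP[p0 pd].
have q0 : 0 <= pos v w x / d by rewrite divr_ge0// ltW.
have q1 : pos v w x / d <= 1 by rewrite ler_pdivrMr// mul1r.
by rewrite /profile -mulrA; apply/andP; split; lra.
Qed.

Lemma profile_lip x y : `|profile x - profile y| <= 2 / d * tdist x y.
Proof.
have -> : profile x - profile y = 2 / d * (pos v w x - pos v w y).
  by rewrite /profile; ring.
rewrite normrM gtr0_norm ?divr_gt0// ler_pM2l ?divr_gt0//.
exact: pos_lip.
Qed.

Lemma profile_continuous : continuous profile.
Proof.
have cp := @pos_continuous _ _ acyclicG v w.
have c1 : continuous (fun _ : gpoint G => 1 : R) by exact: cst_continuous.
have := @continuous_lin R G (2 / d) (-1) _ _ cp c1.
suff -> : (fun x => 2 / d * pos v w x + -1 * 1) = profile by [].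
by apply/funext => x; rewrite /profile; ring.
Qed.

Lemma profile_grad : is_grad profile (fun e _ => 2 / d * slope v w e).
Proof.
apply: is_grad_C1 => [|e t _|e t tl]; [exact: profile_continuous|exact: cvg_cst|].
pose f s : R := profile (chart e 0) + 2 / d * slope v w e * s.
apply: (@near_eq_is_derive _ _ _ f); last first.
  by apply: is_derive_eq; rewrite /GRing.scale /=; ring.
near=> s; rewrite /restr /f /profile (@pos_chart _ _ acyclicG v w e s); first by ring.
have : s \in `]0, len e[ by near: s; apply: near_in_itvoo; rewrite in_itv.
by rewrite in_itv /= => /andP[*]; rewrite !ltW.
Unshelve. all: by end_near. Qed.

Lemma profile_H1 : H1 profile.
Proof. exact: is_grad_H1 profile_continuous profile_grad. Qed.

Lemma profile_dirichlet : dirichlet profile = 4 / d.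
Proof.
rewrite (dirichletE profile_continuous profile_grad).
have -> : \sum_e integ (len e) (fun=> (2 / d * slope v w e) ^+ 2) =
    4 / d ^+ 2 * \sum_e `|coord e (inl v) - coord e (inl w)|.
  rewrite mulr_sumr; apply: eq_bigr => e _; rewrite integ_cst ?len_gt0//.
  have l0 := len_gt0 e.
  case: (slopeP v w e) => -[].
  - by move=> -> ->; rewrite subrr normr0 mulr0 expr0n mul0r mulr0.
  - by move=> -> -> ->; rewrite sub0r normrN gtr0_norm//; field; rewrite gt_eqF.
  - by move=> -> -> ->; rewrite subr0 gtr0_norm//; field; rewrite gt_eqF.
by rewrite -/(tdist _ _) vw; field; rewrite gt_eqF.
Qed.

(** An admissible function goes from [-1] to [1] between points at distance at
    most the diameter, so its Dirichlet integral is at least that of the profile. *)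
Lemma profile_minimizer : limit_minimizer profile.
Proof.
have adm : limit_admissible profile.
  split; first exact: profile_H1.
    split; last by exists (inl w); exact: profile_tgt.
    by move=> x; case/andP: (profile_itv x).
  split; last by exists (inl v); exact: profile_src.
  by move=> x; case/andP: (profile_itv x).
split=> //; apply/le_anti/andP; split; last first.
  apply: ge_inf; last by exists profile.
  by exists 0 => _ [u _ <-]; exact: dirichlet_ge0.
apply: lb_le_inf; first by exists (dirichlet profile), profile.
move=> _ [u [hu [_ [y uy]] [_ [x ux]]] <-].
have := increment_le acyclicG x y hu.
have -> : (u y - u x) ^+ 2 = 4 by rewrite uy ux; ring.
move=> H; rewrite profile_dirichlet ler_pdivrMr// mulrC.
by apply: (le_trans H); rewrite ler_wpM2r ?dirichlet_ge0// tdist_le_diameter.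
Qed.

Section Recentering.
Context (p : R) (p_gt1 : 1 < p).

Let centred (c : R) x := profile x + c.

Let centred_continuous c : continuous (centred c).
Proof. by have [[]] := H1_addc c profile_H1. Qed.

(** The intermediate value theorem in the constant added to the profile. *)
Lemma profile_recentered :
  exists2 c : R, -1 <= c <= 1 & psi_integral p (fun x => profile x + c) = 0.
Proof.
have p0 : 0 < p by rewrite (lt_trans ltr01).
pose F (c : R) := psi_integral p (centred c).
have cF : {in `](-2), 2[, continuous F}.
  move=> c c2; rewrite /F /psi_integral.
  apply: cvg_big => [|e _]; first exact: add_continuous.
  apply: (@continuity_under_integral R _ _ (@lebesgue_measure R)
    (fun c t => psi p (restr (centred c) e t)) `]0, len e[ (measurable_itv _) (-2) 2
    _ _ (fun=> 3 `^ p)) => //.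
  - by move=> b _; exact: psi_integr.
  - apply: aeW => t _ b _; apply: (@continuous_comp R R R (fun b => restr (centred b) e t)).
      by apply: cvgD; [exact: cvg_cst|exact: cvg_id].
    exact: psi_continuous.
  - by apply: continuous_integr => t _; exact: cvg_cst.
  - move=> b; rewrite /= in_itv /= => /andP[b1 b2]; apply: aeW => t _.
    rewrite normr_psi//; apply: ge0_ler_powR; rewrite ?nnegrE ?(ltW p0)//.
    have /andP[q1 q2] := profile_itv (chart e t).
    by rewrite ler_norml /restr /centred; apply/andP; split; lra.
  - by rewrite inE.
have [|||c c1 Fc] := @IVT R F (-1) 1 0.
- lra.
- apply: continuous_in_subspaceT => c; rewrite inE /= in_itv /= => /andP[c1 c2].
  by apply: cF; rewrite in_itv /=; lra.
- have F1 : 0 <= F 1.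
    apply: sumr_ge0 => e _; apply: integ_ge0 => t _; apply: psi_ge0.
    have /andP[q1 q2] := profile_itv (chart e t).
    by rewrite /restr /centred; lra.
  have Fm1 : F (-1) <= 0.
    apply: sumr_le0 => e _; rewrite -[leRHS](mul0r (len e)) -integ_cst ?len_gt0//.
    apply: le_integ => [||t _]; [exact: psi_integr| |].
      by apply: continuous_integr => t _; exact: cvg_cst.
    apply: psi_le0; have /andP[q1 q2] := profile_itv (chart e t).
    by rewrite /restr /centred; lra.
  by rewrite min_l ?max_r ?Fm1 ?F1//; exact: le_trans F1.
by exists c => //; move: c1; rewrite in_itv.
Qed.

End Recentering.

Lemma vertex_segment (z : vertex G) (r : R) : (forall e, r <= len e) -> 0 < r ->
  exists e s, [/\ 0 <= s, s + r <= len e &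
    forall t, s < t < s + r -> tdist (inl z) (chart e t) <= r].
Proof.
move=> rl r0; have [e] : exists e, incident e z.
  have : (0 < degree z)%N by have /orP[/eqP->//|] := degree_1_or_ge3 z; case: degree.
  by case/card_gt0P => e; rewrite inE; exists e.
have re := rl e.
case/orP => /eqP <-.
  exists e, 0; split=> //; first by rewrite add0r.
  move=> t /andP[t0 tr]; rewrite -chart0 tdist_chart ?itv_src//; last lra.
  by rewrite sub0r normrN gtr0_norm; lra.
exists e, (len e - r); split; [lra|lra|].
move=> t /andP[t0 tr]; rewrite -chart_len tdist_chart ?itv_tgt//; last lra.
by rewrite gtr0_norm; lra.
Qed.

(** A constant [c >= 0] moves the value at [w] away from [0], and [c < 0] the value
    at [v]; by the Lipschitz bound the profile stays near that value. *)
Lemma profile_near_end (eta : R) : 0 < eta ->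
  (forall e : edge G, eta * d / 2 <= len e) -> forall c : R,
  exists e s, [/\ 0 <= s, s + eta * d / 2 <= len e &
    forall t, s < t < s + eta * d / 2 -> 1 - eta <= `|profile (chart e t) + c| ].
Proof.
move=> eta0 etal c; have d0 := d_gt0.
have dl0 : 0 < eta * d / 2 by rewrite divr_gt0// mulr_gt0.
have e2 : 2 / d * (eta * d / 2) = eta by field; rewrite gt_eqF.
have near z : forall x, tdist (inl z) x <= eta * d / 2 ->
    `|profile (inl z) - profile x| <= eta.
  move=> x zx; apply: (le_trans (profile_lip _ _)).
  by rewrite -[leRHS]e2 ler_pM2l ?divr_gt0.
have [c0|c0] := leP 0 c.
  have [e [s [s0 sl H]]] := vertex_segment w etal dl0.
  exists e, s; split; [exact: s0|exact: sl|move=> t /H /near].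
  rewrite profile_tgt ler_norml => /andP[_ h]; apply: le_trans (ler_norm _).
  by move: (profile _) h => q h; clear -h c0; lra.
have [e [s [s0 sl H]]] := vertex_segment v etal dl0.
exists e, s; split; [exact: s0|exact: sl|move=> t /H /near].
rewrite profile_src ler_norml -normrN => /andP[h _]; apply: le_trans (ler_norm _).
by move: (profile _) h => q h; clear -h c0; lra.
Qed.

(** The recentred profile is at least [1 - eta] in absolute value on a segment
    next to [v] or to [w]. For large [p] this keeps the maximum of the energy on
    its ray near [2 / d], half the Dirichlet integral of the profile. *)
Lemma least_energy_upper (eta : R) : 0 < eta -> eta < 1 ->
  (forall e : edge G, eta * d / 2 <= len e) ->
  exists2 P : R, 1 < P & forall p, P <= p ->
    (least_energy G p <= (2 / d * ((1 + eta) / (1 - eta)) ^+ 2)%:E)%E.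
Proof.
move=> eta0 eta1 etal; have d0 := d_gt0.
pose dl := eta * d / 2; have dl0 : 0 < dl by rewrite divr_gt0// mulr_gt0.
pose r := 1 - eta; have r0 : 0 < r by rewrite subr_gt0.
pose C := dl * d * r ^+ 2 / 2.
have C0 : 0 < C by rewrite divr_gt0// mulr_gt0 ?exprn_gt0// mulr_gt0.
have b1 : 1 < 1 + eta by lra.
have [P P1 HP] := powR_growth b1 C0.
exists P => // p pP; have p1 : 1 < p by exact: lt_le_trans pP.
have p10 : 0 < p + 1 by lra.
have [c /andP[c1 c2] c_mean] := profile_recentered p1.
have [hf Df] := H1_addc c profile_H1.
pose f x := profile x + c; rewrite -/f in hf Df c_mean.
have [e [s [s0 sl sr]]] := profile_near_end eta0 etal c.
rewrite -/dl -/r in sl sr.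
apply: (@least_energy_le _ _ p f).
  split; [exact: hf| |exact: c_mean] => f0.
  have fw : f (inl w) = 0 by rewrite f0.
  have fv : f (inl v) = 0 by rewrite f0.
  have : (1 + c) - (-1 + c) = 0.
    by rewrite -{1}profile_tgt -profile_src -/(f (inl w)) -/(f (inl v)) fw fv subrr.
  by have -> : 1 + c - (-1 + c) = 2 by [ring]; move/eqP; rewrite pnatr_eq0.
move=> t t0; have htf := H1Z t hf; have [ctf _] := htf.
have tr0 : 0 <= t * r by rewrite mulr_ge0 ?(ltW t0) ?(ltW r0).
have sdl : s <= s + dl by rewrite lerDl ltW.
have trf z : s < z < s + dl -> t * r <= `|restr (fun x => t * f x) e z|.
  by move=> /sr rz; rewrite /restr normrM (gtr0_norm t0) (ler_pM2l t0).
have := @power_integral_lower _ _ p (fun x => t * f x) e s (s + dl) (t * r) p1 ctf tr0 s0 sdl sl trf.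
rewrite addrAC subrr add0r energyE (dirichletZ t hf) Df profile_dirichlet.
move: (power_integral _ _) => N Nlow.
exact: (ray_bound d0 eta0 eta1 dl0 t0 p1 (HP p pP) Nlow).
Qed.

End Profile.

(** * Asymptotics of least energy solutions *)

Section Asymptotics.
Context {R : realType} (G : metric_graph R) (acyclicG : without_cycles G).
Implicit Types (e : edge G) (x y : gpoint G) (v w : vertex G) (u : gpoint G -> R) (p : R).
Local Notation d := (vertex_diameter G).
Local Notation L := (total_length G).

Let d_gt0 : 0 < d. Proof. exact: vertex_diameter_gt0. Qed.
Let L_gt0 : 0 < L. Proof. exact: total_length_gt0. Qed.

Lemma les_energy p u : 1 < p -> least_energy_solution p u ->
  energy p u = dirichlet u / 2 - (p + 1)^-1 * dirichlet u.
Proof.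
move=> p1 [sol _]; rewrite energyE; congr (_ - _ * _).
by rewrite (solution_dirichlet p1 sol).
Qed.

Lemma les_dirichlet_lower p u : 1 < p -> 4 * L ^+ 2 <= p + 1 ->
  least_energy_solution p u -> (2 * L)^-1 <= dirichlet u.
Proof.
move=> p1 pL les; have D0 := dirichlet_ge0 u; have L0 := L_gt0.
have := least_energy_lower acyclicG p1 pL; rewrite -les.2 lee_fin les_energy// => H.
have p10 : 0 < p + 1 by rewrite ltr_pwDr// ltW// (lt_trans ltr01).
have q0 : 0 <= (p + 1)^-1 * dirichlet u by rewrite mulr_ge0// invr_ge0 ltW.
have -> : (2 * L)^-1 = 2 * (4 * L)^-1 by field; rewrite gt_eqF.
move: ((4 * L)^-1) ((p + 1)^-1 * _) H q0 => a b; move: (dirichlet u) => D.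
by clear; lra.
Qed.

Lemma min_edge_length : exists2 r : R, 0 < r & forall e : edge G, r <= len e.
Proof.
apply: (common_radius (P := fun (e : edge G) r => r <= len e)).
  by move=> e r s; exact: le_trans.
by move=> e; exists (len e); rewrite ?len_gt0.
Qed.

(** Here [c] is [4 / d] and [q] is [1 / (p + 1)]. The constant [9] comes from
    [(1 + eta) ^ 2 <= (1 + 9 * eta) * (1 - eta) ^ 3] for [eta <= 1 / 8]. *)
Lemma upper_constant (D q eta eps c : R) : 0 < c -> 0 < eta -> eta <= 8^-1 ->
  eta * 9 * c <= eps -> 0 <= D -> q <= eta / 2 ->
  D / 2 - q * D <= c / 2 * ((1 + eta) / (1 - eta)) ^+ 2 -> D <= c + eps.
Proof.
move=> c0 eta0 eta8 ce D0 qe H; have r0 : 0 < 1 - eta by lra.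
have H1 : D * (1 - eta) <= c * ((1 + eta) / (1 - eta)) ^+ 2.
  have : q * D <= eta / 2 * D by rewrite ler_wpM2r.
  lra.
have {}H1 : D * (1 - eta) ^+ 3 <= c * (1 + eta) ^+ 2.
  have -> : D * (1 - eta) ^+ 3 = D * (1 - eta) * (1 - eta) ^+ 2 by ring.
  have -> : c * (1 + eta) ^+ 2 = c * ((1 + eta) / (1 - eta)) ^+ 2 * (1 - eta) ^+ 2.
    by field; rewrite gt_eqF.
  by rewrite ler_wpM2r// sqr_ge0.
have H2 : (1 + eta) ^+ 2 <= (1 + 9 * eta) * (1 - eta) ^+ 3.
  have e2 : 0 <= eta * (8^-1 - eta) by rewrite mulr_ge0 ?subr_ge0// ltW.
  have e3 : 0 <= eta ^+ 2 * (8^-1 - eta) by rewrite mulr_ge0 ?subr_ge0 ?sqr_ge0.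
  nra.
have H3 : D * (1 - eta) ^+ 3 <= c * (1 + 9 * eta) * (1 - eta) ^+ 3.
  by apply: (le_trans H1); rewrite -mulrA ler_wpM2l// ltW.
by move: H3; rewrite ler_pM2r ?exprn_gt0//; lra.
Qed.

Lemma les_dirichlet_upper (eps : R) : 0 < eps -> exists2 P : R, 1 < P &
  forall p, P <= p -> forall u, least_energy_solution p u -> dirichlet u <= 4 / d + eps.
Proof.
move=> eps0; have d0 := d_gt0; have [v [w vw]] := diametral_vertices G.
have [r r0 rl] := min_edge_length.
pose eta := Num.min 8^-1 (Num.min (eps * d / 36) (2 * r / d)).
have eta0 : 0 < eta.
  by rewrite !lt_min invr_gt0 ltr0n !divr_gt0 ?mulr_gt0.
have eta8 : eta <= 8^-1 by rewrite ge_min lexx.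
have etaeps : eta <= eps * d / 36 by rewrite !ge_min lexx orbT.
have etar : eta <= 2 * r / d by rewrite !ge_min lexx !orbT.
have eta1 : eta < 1 by apply: (le_lt_trans eta8); rewrite invf_lt1 ?ltr1n.
have etal e : eta * d / 2 <= len e.
  apply: le_trans (rl e); rewrite ler_pdivrMr// mulrC.
  by rewrite -ler_pdivlMl// mulrC [r * 2]mulrC.
have [P P1 HP] := least_energy_upper acyclicG vw eta0 eta1 etal.
exists (Num.max P (2 / eta)); first by rewrite lt_max P1.
move=> p; rewrite ge_max => /andP[pP peta] u les.
have p1 : 1 < p by exact: lt_le_trans pP.
have := HP p pP; rewrite -les.2 lee_fin les_energy//.
have d40 : 0 < 4 / d by rewrite divr_gt0.
have p10 : 0 < p + 1 by rewrite ltr_pwDr// ltW// (lt_trans ltr01).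
have -> : 2 / d = 4 / d / 2 by field; rewrite gt_eqF.
apply: (upper_constant d40 eta0 eta8 _ (dirichlet_ge0 u)).
  rewrite -[leRHS](_ : eps * d / 36 * 9 * (4 / d) = eps); last by field; rewrite gt_eqF.
  by rewrite ler_pM2r// ler_pM2r.
rewrite -[leLHS]mul1r ler_pdivrMr// -ler_pdivrMl ?divr_gt0// mulr1 invf_div.
by apply: (le_trans peta); rewrite lerDl.
Qed.

(** If [u <= r < 1], then the positive part of [psi p u] is at most [r ^ p], so
    is the mean of its negative part, and [|u| ^ (p + 1)] would have a small
    integral. *)
Lemma max_lower (B eps : R) : 0 < eps -> eps < 1 -> exists2 P : R, 1 < P &
  forall p, P <= p -> forall u, H1 u -> psi_integral p u = 0 ->
    dirichlet u = power_integral p u -> (2 * L)^-1 <= dirichlet u -> dirichlet u <= B ->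
    exists x, 1 - eps <= u x.
Proof.
move=> eps0 eps1; have L0 := L_gt0; pose r := 1 - eps.
have r0 : 0 < r by rewrite subr_gt0.
have r1 : r < 1 by rewrite gtrBl.
pose M := Num.sqrt (L * B); have M0 : 0 <= M by exact: sqrtr_ge0.
have M1 : 0 < M + 1 by rewrite ltr_wpDl.
pose c := (8 * L ^+ 2 * (M + 1))^-1.
have c0 : 0 < c by rewrite invr_gt0 !mulr_gt0 ?exprn_gt0.
have [P P1 HP] := powR_decay r0 r1 c0.
exists P => // p pP u hu u0 DN Dlow Dup; have [cu _] := hu.
have p1 : 1 < p by exact: lt_le_trans pP.
have p0 : 0 < p by exact: lt_trans p1.
apply: contrapT => nex.
have ur x : u x <= r by rewrite leNgt; apply/negP => ux; apply: nex; exists x; exact: ltW.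
have uM x : `|u x| <= M.
  rewrite -(ler_pXn2r (n := 2)) ?nnegrE// real_normK ?num_real//.
  rewrite sqr_sqrtr; first exact: le_trans (sup_bound acyclicG x p1 hu u0)
    (ler_wpM2l (ltW L0) Dup).
  by rewrite mulr_ge0 ?(ltW L0)// (le_trans _ Dup)// dirichlet_ge0.
have pt := power_le_psi p0 (ltW r0) M0.
have Nup : power_integral p u <= M * (2 * r `^ p) * L.
  have -> : M * (2 * r `^ p) * L = M * (2 * r `^ p) * L - M * psi_integral p u.
    by rewrite u0 mulr0 subr0.
  rewrite /total_length /psi_integral !mulr_sumr -sumrB; apply: ler_sum => e _.
  have i1 : integr (len e) (fun=> M * (2 * r `^ p)).
    by apply: continuous_integr => t _; exact: cvg_cst.
  have i2 := psi_integr e p1 cu.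
  rewrite -(integ_cst (M * (2 * r `^ p)) (len_gt0 e)) -(integZ M i2) -(integB i1 (integrZ M i2)).
  apply: le_integ; [exact: power_integral_integr|apply: integrB => //; exact: integrZ|].
  by move=> t _; apply: pt; rewrite /restr.
have := HP p pP; move: (r `^ p) (powR_ge0 r p) Nup => rp rp0 Nup rpc.
have : (2 * L)^-1 <= M * (2 * c) * L.
  apply: (le_trans Dlow); rewrite DN; apply: (le_trans Nup).
  by rewrite ler_wpM2r ?(ltW L0)// ler_wpM2l// ler_wpM2l.
have -> : M * (2 * c) * L = (2 * L)^-1 * (M / (M + 1) / 2).
  by rewrite /c; field; rewrite !gt_eqF.
rewrite -[leLHS]mulr1 ler_pM2l ?invr_gt0 ?mulr_gt0//.
apply/negP; rewrite -ltNge ltr_pdivrMr// mul1r ltr_pdivrMr//.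
by clear -M0; lra.
Qed.

(** There are finitely many distances between vertices. *)
Lemma diameter_gap : exists2 r : R, 0 < r &
  forall v w, d - r < tdist (inl v) (inl w) -> tdist (inl v : gpoint G) (inl w) = d.
Proof.
have [|i|r r0 H] := @common_radius R (vertex G * vertex G)%type (fun i r =>
    d - r < tdist (inl i.1 : gpoint G) (inl i.2) -> tdist (inl i.1 : gpoint G) (inl i.2) = d).
- by move=> i r s sr H h; apply: H; apply: le_lt_trans h; rewrite lerB.
- have [->|Td] := eqVneq (tdist (inl i.1 : gpoint G) (inl i.2)) d; first by exists 1.
  exists (d - tdist (inl i.1 : gpoint G) (inl i.2)).
    by rewrite subr_gt0 lt_neqAle Td tdist_le_diameter.
  by rewrite opprB addrC subrK ltxx.
by exists r => // v w; exact: (H (v, w)).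
Qed.

(** In the three estimates below [c] is the diameter and [D] the Dirichlet
    integral of a solution. Here [T] is the distance of its extrema. *)
Lemma distance_defect (c T D eps : R) : 0 < c -> 0 <= eps -> T <= c ->
  0 <= T -> D <= 4 / c + eps -> (2 - 2 * eps) ^+ 2 <= T * D ->
  c - T <= c * (c + 8) / 4 * eps.
Proof.
move=> c0 e0 Tc T0 De H.
have : (2 - 2 * eps) ^+ 2 <= T * (4 / c + eps).
  by apply: (le_trans H); rewrite ler_wpM2l.
rewrite -(ler_pM2l c0).
have -> : c * (T * (4 / c + eps)) = T * (4 + c * eps) by field; rewrite gt_eqF.
have ce0 : 0 <= c * eps by rewrite mulr_ge0// ltW.
have cee : 0 <= c * eps ^+ 2 by rewrite mulr_ge0 ?sqr_ge0// ltW.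
have cT : 0 <= (c - T) * (c * eps) by rewrite mulr_ge0// subr_ge0.
by move=> h; lra.
Qed.

(** Here [ua] and [ub] are the values at two vertices at distance [c]. *)
Lemma value_at_end (c eps s ua ub D : R) : 0 < c -> 0 <= eps -> 0 <= s ->
  D <= 4 / c + eps -> (ub - ua) ^+ 2 <= c * D ->
  1 - eps - s <= ub -> ua <= -1 + eps + s ->
  `|ua + 1| <= eps * (1 + c) + s.
Proof.
move=> c0 e0 s0 De H Hb Ha.
have ce0 : 0 <= c * eps by rewrite mulr_ge0// ltW.
have {}H : (ub - ua) ^+ 2 <= (2 + c * eps) ^+ 2.
  apply: (le_trans H); apply: (@le_trans _ _ (c * (4 / c + eps))).
    by rewrite ler_wpM2l// ltW.
  have -> : c * (4 / c + eps) = 4 + c * eps by field; rewrite gt_eqF.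
  by have := sqr_ge0 (c * eps); rewrite sqrrD; lra.
have {}H : ub - ua <= 2 + c * eps.
  apply: le_trans (ler_norm _) _; rewrite -(ler_pXn2r (n := 2)) ?nnegrE//.
    by rewrite real_normK ?num_real.
  by rewrite addr_ge0.
by rewrite ler_norml; apply/andP; split; lra.
Qed.

(** Here [E] is the Dirichlet integral of the half sum of the solution and the
    profile, as in the parallelogram identity. *)
Lemma gradient_defect (c eps s ua ub D E : R) : 0 < c -> 0 <= eps -> 0 <= s ->
  eps + s <= 2 -> D <= 4 / c + eps ->
  ((ub + 1) / 2 - (ua - 1) / 2) ^+ 2 <= c * E ->
  1 - eps - s <= ub -> ua <= -1 + eps + s ->
  2 * D + 2 * (4 / c) - 4 * E <= 2 * eps + 16 / c * (eps + s).
Proof.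
move=> c0 e0 s0 es De H Hb Ha.
have : (2 - (eps + s)) ^+ 2 <= c * E.
  by apply: le_trans H; rewrite lerXn2r// ?nnegrE; lra.
have q := sqr_ge0 (eps + s); rewrite -ler_pdivrMl// => H'.
have {}H' : (4 - 4 * (eps + s)) / c <= E.
  apply: le_trans H'; rewrite mulrC ler_pM2l ?invr_gt0//.
  by rewrite sqrrB; lra.
have -> : 2 * eps + 16 / c * (eps + s) =
    2 * (4 / c + eps) + 2 * (4 / c) - 4 * ((4 - 4 * (eps + s)) / c).
  by field; rewrite gt_eqF.
by rewrite lerB// ?ler_wpM2l// lerD2r ler_wpM2l.
Qed.

(** For large [p] the extrema of [u] are almost at distance [d], hence close to
    the ends of a diametral pair of vertices. The half sum of [u] and the profile
    has nearly the same increment between these ends, so by Cauchy-Schwarz its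
    Dirichlet integral is almost [4 / d], and the parallelogram identity bounds
    the difference. *)
Lemma concentration (s : R) : 0 < s -> s <= 1 -> exists2 P : R, 1 < P &
  forall p, P <= p -> forall u, least_energy_solution p u ->
    exists v w, [/\ tdist (inl v : gpoint G) (inl w) = d,
      dirichlet (fun x => u x - profile v w x) <= (2 + 32 / d + d) * s
    & `|u (inl v) + 1| <= (2 + 32 / d + d) * s].
Proof.
move=> s0 s1; have d0 := d_gt0; have [gap gap0 gapP] := diameter_gap.
pose K := d * (d + 8) / 4.
have K0 : 0 < K by rewrite divr_gt0// mulr_gt0// addr_gt0.
have d4 : 0 < 4 / d by rewrite divr_gt0.
have d41 : 0 < 4 / d + 1 by rewrite addr_gt0.
(* [K * eps] will bound both the defect [d - tdist x y] and the distances of the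
   extrema to the vertices; over such a distance [u] varies by at most [s]. *)
pose eps := Num.min (Num.min s 2^-1) (Num.min (s ^+ 2 / (K * (4 / d + 1))) (gap / (2 * K))).
have eps0 : 0 < eps.
  have a0 : 0 < s ^+ 2 / (K * (4 / d + 1)) by rewrite divr_gt0 ?exprn_gt0// mulr_gt0.
  have b0 : 0 < gap / (2 * K) by rewrite divr_gt0// mulr_gt0.
  by rewrite !lt_min s0 a0 b0 invr_gt0 ltr0n.
have es : eps <= s by rewrite !ge_min lexx.
have e2 : eps <= 2^-1 by rewrite !ge_min lexx orbT.
have eK : eps <= s ^+ 2 / (K * (4 / d + 1)) by rewrite !ge_min lexx !orbT.
have eg : eps <= gap / (2 * K) by rewrite !ge_min lexx !orbT.
have e1 : eps < 1 by apply: (le_lt_trans e2); rewrite invf_lt1 ?ltr1n.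
clearbody eps.
have [P1 P11 upper] := les_dirichlet_upper eps0.
have [P2 P21 low] := max_lower (4 / d + eps) eps0 e1.
exists (Num.max (Num.max P1 P2) (4 * L ^+ 2)); first by rewrite !lt_max P11.
move=> p; rewrite !ge_max => /andP[/andP[pP1 pP2] pL] u les.
have p1 : 1 < p by exact: lt_le_trans pP1.
have [sol _] := les; have hu := solution_H1 p1 sol; have [cu _] := hu.
have u0 : psi_integral p u = 0 := solution_mean0 p1 sol.
have DN : dirichlet u = power_integral p u := solution_dirichlet p1 sol.
have Dup := upper p pP1 u les.
have Dlow : (2 * L)^-1 <= dirichlet u.
  by apply: (les_dirichlet_lower p1) => //; rewrite (le_trans pL)// lerDl.
have [x ux] := low p pP2 u hu u0 DN Dlow Dup.
have [y uy] : exists y, 1 - eps <= - u y.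
  have hNu := H1Z (-1) hu; have DNu := dirichletZ (-1) hu.
  have eN : (fun z => -1 * u z) = (fun z => - u z).
    by apply/funext => z; rewrite mulN1r.
  rewrite eN sqrrN expr1n mul1r in hNu DNu.
  have Nu0 : psi_integral p (fun z => - u z) = 0.
    by rewrite (psi_integralN p1 cu) u0 oppr0.
  have NN : dirichlet (fun z => - u z) = power_integral p (fun z => - u z).
    rewrite DNu DN; apply: eq_bigr => e _; apply: eq_integ => t _.
    by rewrite /restr normrN.
  by apply: (low p pP2 _ hNu Nu0 NN); rewrite DNu; [exact: Dlow|exact: Dup].
have [w xw] := extend_to_vertex acyclicG x y; have [v yv] := extend_to_vertex acyclicG y (inl w).
have inc a b : (u b - u a) ^+ 2 <= tdist a b * dirichlet u.
  exact: increment_le.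
have Txy := tdist_le_diameter acyclicG x y.
have defect : d - tdist x y <= K * eps.
  apply: (distance_defect d0 (ltW eps0) Txy (tdist_ge0 _ _) Dup).
  rewrite (tdistC x y); apply: le_trans (inc y x).
  by rewrite lerXn2r// ?nnegrE; move: ux uy e2; clear; move: (u x) (u y) => a b; lra.
have Tvw := tdist_le_diameter acyclicG (inl v : gpoint G) (inl w).
rewrite yv (tdistC y) xw in Tvw.
have Tvy0 := tdist_ge0 (inl v : gpoint G) y; have Twx0 := tdist_ge0 (inl w : gpoint G) x.
have Twx : tdist (inl w) x <= K * eps by lra.
have Tvy : tdist (inl v) y <= K * eps by lra.
have vw : tdist (inl v : gpoint G) (inl w) = d.
  apply: gapP; rewrite yv (tdistC y) xw.
  have : K * eps < gap.
    rewrite -ltr_pdivlMl//; apply: (le_lt_trans eg).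
    rewrite mulrC ltr_pM2r// invfM gtr_pMl ?invr_gt0// invf_lt1 ?ltr1n//.
  lra.
have close a b : tdist a b <= K * eps -> `|u b - u a| <= s.
  move=> ab; rewrite -(ler_pXn2r (n := 2)) ?nnegrE ?(ltW s0)// real_normK ?num_real//.
  apply: (le_trans (inc a b)); apply: (@le_trans _ _ (K * eps * (4 / d + 1))).
    apply: ler_pM; rewrite ?tdist_ge0 ?dirichlet_ge0//.
    by apply: (le_trans Dup); rewrite lerD2l (le_trans es).
  by rewrite mulrAC mulrC -ler_pdivlMr// mulr_gt0.
have uw : 1 - eps - s <= u (inl w).
  have := close _ _ Twx; rewrite ler_norml => /andP[_]; move: ux; clear.
  by move: (u _) (u _) => a b; lra.
have uv : u (inl v) <= -1 + eps + s.
  have := close _ _ Tvy; rewrite ler_norml => /andP[+ _]; move: uy; clear.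
  by move: (u _) (u _) => a b; lra.
have inc_vw := inc (inl v) (inl w); rewrite vw in inc_vw.
exists v, w; split; first exact: vw.
- have hg := profile_H1 acyclicG v w.
  rewrite (parallelogram hu hg) (profile_dirichlet acyclicG vw).
  have hh : H1 (fun z => (u z + profile v w z) / 2).
    rewrite (_ : (fun z => _) = fun z => 2^-1 * u z + 2^-1 * profile v w z); first exact: H1_lin.
    by apply/funext => z; ring.
  have := increment_le acyclicG (inl v) (inl w) hh.
  rewrite vw profile_src (profile_tgt acyclicG vw) => inc_h.
  have es2 : eps + s <= 2 by clear -s1 e2; lra.
  apply: (le_trans (gradient_defect d0 (ltW eps0) (ltW s0) es2 Dup inc_h uw uv)).
  have -> : (2 + 32 / d + d) * s = 2 * s + 16 / d * (s + s) + d * s by field; rewrite gt_eqF.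
  apply: ler_wpDr; first exact: mulr_ge0 (ltW d0) (ltW s0).
  apply: lerD; first by rewrite ler_pM2l.
  by rewrite ler_wpM2l ?lerD2r// ltW// divr_gt0.
apply: (le_trans (value_at_end d0 (ltW eps0) (ltW s0) Dup inc_vw uw uv)).
have -> : (2 + 32 / d + d) * s = s * (1 + d) + s + 32 / d * s by ring.
apply: ler_wpDr; first by rewrite mulr_ge0 ?(ltW s0)// ltW// divr_gt0.
by rewrite lerD2r ler_wpM2r// addr_ge0 ?ler01// ltW.
Qed.

(** By [increment_le], [f] varies by at most the root of [d * dirichlet f]. *)
Lemma small_from_gradient v (eps : R) : 0 < eps -> exists2 e0 : R, 0 < e0 &
  forall f, H1 f -> dirichlet f <= e0 -> `|f (inl v)| <= e0 ->
    (forall x, `|f x| < eps) /\ norm_H1 f <= eps.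
Proof.
move=> eps0; have d0 := d_gt0; have L0 := L_gt0.
have L1 : 0 < L + 1 by rewrite addr_gt0.
pose tau := Num.min (eps / 4) (eps / (4 * (L + 1))).
have tau0 : 0 < tau by rewrite lt_min !divr_gt0 ?mulr_gt0.
have tau_eps : tau <= eps / 4 by rewrite ge_min lexx.
have tau_L : tau <= eps / (4 * (L + 1)) by rewrite ge_min lexx orbT.
clearbody tau.
pose e0 := Num.min tau (Num.min (tau ^+ 2 / d) (eps ^+ 2 / 2)).
have e00 : 0 < e0.
  by rewrite !lt_min tau0 !divr_gt0 ?exprn_gt0.
have e_tau : e0 <= tau by rewrite ge_min lexx.
have e_d : e0 <= tau ^+ 2 / d by rewrite !ge_min lexx orbT.
have e_eps : e0 <= eps ^+ 2 / 2 by rewrite !ge_min lexx !orbT.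
clearbody e0.
exists e0; first exact: e00.
move=> f hf Df fv; have [cf _] := hf.
have f2 x : `|f x| <= 2 * tau.
  have fx : `|f x - f (inl v)| <= tau.
    rewrite -(ler_pXn2r (n := 2)) ?nnegrE ?(ltW tau0)// real_normK ?num_real//.
    apply: (le_trans (increment_le acyclicG (inl v) x hf)).
    apply: (@le_trans _ _ (d * e0)).
      by apply: ler_pM; rewrite ?tdist_ge0 ?dirichlet_ge0 ?tdist_le_diameter.
    by rewrite mulrC -ler_pdivlMr.
  rewrite -(subrK (f (inl v)) (f x)); apply: (le_trans (ler_normD _ _)).
  have -> : 2 * tau = tau + tau by ring.
  by apply: lerD; [exact: fx|exact: le_trans fv e_tau].
split=> [x|].
  apply: (le_lt_trans (f2 x)); apply: (@le_lt_trans _ _ (eps / 2)).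
    by have -> : eps / 2 = 2 * (eps / 4) by [field]; rewrite ler_pM2l.
  by rewrite ltr_pdivrMr// ltr_pMr// ltr1n.
have gi e : integr (len e) (fun t => `|grad f e t| ^+ 2).
  have [_ hfe] := hf; have [_ [g gi gw]] := hfe e.
  have [hi _] : square_integrable (len e) (grad f e) /\
      is_weak_derivative (len e) (restr f e) (grad f e).
    by rewrite /grad /weak_derivative; case: xgetP => [h _ //|/(_ g)]; case.
  have -> : (fun t => `|grad f e t| ^+ 2) = (fun t => grad f e t ^+ 2).
    by apply/funext => t; rewrite real_normK ?num_real.
  exact: sqi_integr2 hi.
have fi e : integr (len e) (fun t => restr f e t ^+ 2) := sqi_integr2 (restr_sqi e cf).
have split_norm : graph_integral (fun e t => `|grad f e t| ^+ 2 + restr f e t ^+ 2) =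
    dirichlet f + \sum_e integ (len e) (fun t => restr f e t ^+ 2).
  by rewrite -big_split; apply: eq_bigr => e _; exact: (integD (gi e) (fi e)).
have L2 : \sum_e integ (len e) (fun t => restr f e t ^+ 2) <= (2 * tau) ^+ 2 * L.
  rewrite /total_length mulr_sumr; apply: ler_sum => e _.
  rewrite -(integ_cst _ (len_gt0 e)); apply: le_integ; first exact: fi.
    by apply: continuous_integr => t _; exact: cvg_cst.
  move=> t _; rewrite -(real_normK (num_real (restr f e t))).
  by rewrite lerXn2r ?nnegrE ?mulr_ge0 ?(ltW tau0)//; exact: f2.
rewrite /norm_H1 split_norm -(ger0_norm (ltW eps0)) -sqrtr_sqr.
rewrite ler_wsqrtr//; apply: (le_trans (lerD Df L2)).
have : tau * (L + 1) <= eps / 4.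
  rewrite -ler_pdivlMr//; apply: (le_trans tau_L).
  by have -> : eps / (4 * (L + 1)) = eps / 4 / (L + 1) by field; rewrite gt_eqF.
move=> tL; have tL' : tau * L <= eps / 4 by apply: le_trans tL; rewrite ler_pM2l// lerDl.
have : tau * (tau * L) <= eps / 4 * (eps / 4).
  by apply: ler_pM; rewrite ?mulr_ge0 ?(ltW tau0) ?(ltW L0).
have := sqr_ge0 eps; rewrite exprMn => h2 h3.
have -> : 2 ^+ 2 * tau ^+ 2 * L = 4 * (tau * (tau * L)) by ring.
by move: h3; move: (tau * (tau * L)) => q h3; clear -h2 h3 e_eps; rewrite expr2 in h2 e_eps *; lra.
Qed.

(** Otherwise each [i] fails for some tolerance and all large [n], and as there are
    finitely many [i], they all fail for a common tolerance and the same [n]. *)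
Lemma recurrent_index (T : finType) (P : T -> R -> nat -> Prop) :
  (forall i r s n, s <= r -> P i s n -> P i r n) ->
  (forall r, 0 < r -> exists N, forall n, (N <= n)%N -> exists i, P i r n) ->
  exists i, forall r N, 0 < r -> exists2 n, (N <= n)%N & P i r n.
Proof.
move=> mono ev; apply: contrapT => nex.
have [|i|r r0 rP] := @common_radius R T
    (fun i r => exists N, forall n, (N <= n)%N -> ~ P i r n).
- by move=> i r s sr [N H]; exists N => n /H h Ps; apply: h; exact: mono sr Ps.
- apply: contrapT => H; apply: nex; exists i => r N r0; apply: contrapT => H'.
  apply: H; exists r => //; exists N => n Nn Pn; apply: H'; by exists n.
have [N NP] := choice rP; have [M MP] := ev r r0.
have [i Pi] := MP (maxn M (\max_i N i)) (leq_maxl _ _).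
by apply: (NP i) Pi; rewrite (leq_trans _ (leq_maxr _ _))// leq_bigmax.
Qed.

Lemma extraction (P : R -> nat -> Prop) :
  (forall r N, 0 < r -> exists2 n, (N <= n)%N & P r n) ->
  exists k : nat -> nat, {homo k : m n / (m < n)%N} /\ forall n, P n.+1%:R^-1 (k n).
Proof.
move=> H; have ex (mN : nat * nat) : exists n, (mN.2 <= n)%N /\ P mN.1.+1%:R^-1 n.
  have inv0 : 0 < mN.1.+1%:R^-1 :> R by rewrite invr_gt0 ltr0n.
  by have [n Nn Pn] := H _ mN.2 inv0; exists n.
have [f fP] := choice ex.
pose k := fix k n := if n is m.+1 then f (m.+1, (k m).+1) else f (0%N, 0%N).
exists k; split.
  apply: homo_ltn => [b a c|n]; first exact: ltn_trans.
  by have [] := fP (n.+1, (k n).+1).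
by case=> [|n]; [have [] := fP (0%N, 0%N)|have [] := fP (n.+1, (k n).+1)].
Qed.

End Asymptotics.

Theorem theorem3 (R : realType) (G : metric_graph R) (u_ : R -> gpoint G -> R)
    (acyclicG : without_cycles G)
    (les_u : forall p : R, 1 < p -> least_energy_solution p (u_ p)) :
  forall p_ : nat -> R, (forall n, 1 < p_ n) -> p_ n @[n --> \oo] --> +oo ->
  exists (k : nat -> nat) (a b : gpoint G) (uoo : gpoint G -> R),
    {homo k : m n / (m < n)%N} /\
    diametral a b /\
    cvg_H1 (fun n => u_ (p_ (k n))) uoo /\
    {uniform, (fun n => u_ (p_ (k n))) @ \oo --> uoo} /\
    limit_minimizer uoo /\
    uoo a = -1 /\
    uoo b = 1 /\
    exists U : set (gpoint G),
      unique (is_path a b) U /\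
      (forall x, U x -> uoo x = -1 + 2 * dist a x / dist a b) /\
      (forall x y, connected_component (~` U) x y -> uoo x = uoo y).

Proof.
move=> p_ p_gt1 p_oo; pose d := vertex_diameter G.
have d0 : 0 < d by exact: vertex_diameter_gt0.
(* [good (v, w) e n]: up to [e], the solution of index [n] is the profile of the
   diametral pair [(v, w)]. *)
pose good (i : vertex G * vertex G) (e : R) (n : nat) :=
  [/\ tdist (inl i.1 : gpoint G) (inl i.2) = d,
      dirichlet (fun x => u_ (p_ n) x - profile i.1 i.2 x) <= e
    & `|u_ (p_ n) (inl i.1) + 1| <= e].
have [[v w] vwP] : exists i, forall r N, 0 < r -> exists2 n, (N <= n)%N & good i r n.
  apply: recurrent_index => [i r s n sr [id iD iu]|r r0].
    by split; [exact: id|exact: le_trans sr|exact: le_trans sr].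
  (* the constant in [concentration] *)
  pose C := 2 + 32 / d + d.
  have C0 : 0 < C by rewrite !addr_gt0// divr_gt0.
  pose s := Num.min 1 (r / C).
  have s0 : 0 < s by rewrite lt_min ltr01 divr_gt0.
  have s1 : s <= 1 by rewrite ge_min lexx.
  have Cs : C * s <= r by rewrite mulrC -ler_pdivlMr// ge_min lexx orbT.
  have [P P1 HP] := concentration acyclicG s0 s1.
  have /cvgryPge/(_ P)[N _ NP] := p_oo.
  exists N => n /NP /= Pn.
  have [a [b [ab D1 D2]]] := HP _ Pn _ (les_u _ (p_gt1 n)).
  by exists (a, b); split; [exact: ab|exact: le_trans Cs|exact: le_trans Cs].
have [k [k_homo kP]] := extraction vwP.
have [vw _ _] := kP 0%N; rewrite /= in vw.
have v_neq_w : v != w by apply/eqP => vw'; move: d0; rewrite -vw vw' tdistxx ltxx.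
pose f_ n x := u_ (p_ (k n)) x - profile v w x.
have Hu n : H1 (u_ (p_ (k n))).
  by have [sol _] := les_u _ (p_gt1 (k n)); exact: solution_H1 (p_gt1 (k n)) sol.
have Hg := profile_H1 acyclicG v w.
have Hf n : H1 (f_ n).
  rewrite (_ : f_ n = fun x => 1 * u_ (p_ (k n)) x + -1 * profile v w x); first exact: H1_lin.
  by apply/funext => x; rewrite /f_; ring.
have small eps : 0 < eps ->
    \forall n \near \oo, (forall x, `|f_ n x| < eps) /\ norm_H1 (f_ n) <= eps.
  move=> eps0; have [e0 e00 e0P] := small_from_gradient acyclicG v eps0.
  near=> n.
  have ne : n.+1%:R^-1 <= e0.
    by apply: ltW; near: n; exact: (near_infty_natSinv_lt (PosNum e00)).
  have [_ Dn un] := kP n.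
  apply: (e0P _ (Hf n)); first exact: le_trans ne.
  by rewrite /f_ profile_src opprK; exact: le_trans ne.
exists k, (inl v), (inl w), (profile v w); split; first exact: k_homo.
split; first exact: diametralP.
split.
  split; [exact: Hu|exact: Hg|].
  apply/cvgr0Pnorm_le => eps eps0.
  near=> n; rewrite ger0_norm ?sqrtr_ge0//.
  have : (forall x, `|f_ n x| < eps) /\ norm_H1 (f_ n) <= eps.
    by near: n; exact: small.
  by case.
split.
  move=> A /uniform_nbhs[E [entE EA]].
  have [e e0 eE] : exists2 e : R, 0 < e & forall a b : R, `|a - b| < e -> E (a, b).
    move: entE; rewrite -entourage_ballE => -[e e0 eE].
    by exists e => // a b ab; exact: (eE (a, b)).
  change (\forall n \near \oo, A (fun x => u_ (p_ (k n)) x)).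
  apply: filterS (small e e0) => n [fe _]; apply: EA => x _ /=.
  by apply: eE; rewrite distrC; exact: fe.
split; first exact: profile_minimizer.
split; first exact: profile_src.
split; first exact: profile_tgt.
exists (geodesic v w); split; last split.
- split; first exact: geodesic_is_path.
  by move=> U /(path_is_geodesic acyclicG).
- move=> x Ux; rewrite !distE// vw /profile.
  have p0 := pos_itv acyclicG v w x; case/andP: p0 => p0 _.
  have Uv : geodesic v w (inl v) by exact: geodesic_src.
  rewrite (geodesic_tdist acyclicG Uv Ux).
  by rewrite pos_src sub0r normrN ger0_norm.
- by move=> x y /(pos_component acyclicG) xy; rewrite /profile xy.
Unshelve. all: by end_near. Qed.
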